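(* Let $d\ge2$, $H=\{x\in\mathbb{R}^d:x([d])=0\}$ and $P=\operatorname{conv}\{\pm(e_i-e_j):1\le i<j\le d\}\subset H$. Let $\mathcal{G}$ be the polyhedral fan in $H$ induced by the regions of linearity of the function $p:H\to\mathbb{R}$, $$p(a)=\sum_{I\subseteq[d]}\left(f_I(a)+g_I(a)\right),$$ where $$f_I(a)=\max\left(\{a(K)\}_{K\subseteq I}\cup\{a(K)\}_{K\subseteq I^c}\right),\qquad g_I(a)=\min\left(\{a(K)\}_{K\subseteq I}\cup\{a(K)\}_{K\subseteq I^c}\right).$$ Let $\mathcal{H}$ be the fan in $H$ induced by the resonance arrangement restricted to $H$. Then the bisection fan $\Delta$ of the discrete Wasserstein distance (i.e. of $P$) is given by the common refinement of $\mathcal{G}$ and $\mathcal{H}$.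
   Context: $[d]=\{1,\dots,d\}$, $I^c=[d]\setminus I$, $x(K)=\sum_{i\in K}x_i$ (with $x(\emptyset)=0$). The resonance arrangement consists of all hyperplanes $x(I)=0$, $\emptyset\neq I\subseteq[d]$; restricted to $H$, the index $I=[d]$ gives all of $H$ and imposes no condition. The regions of linearity of a piecewise linear function are the closures of the connected components of the open set of points near which the function is linear. The common refinement of two fans consists of all intersections of a cone of one with a cone of the other. The discrete Wasserstein distance on $H$ is $\operatorname{dist}^P(a,b)=\min\{\alpha\ge0:b-a\in\alpha P\}$, where $P$ is full-dimensional in $H$. The bisector is $\operatorname{bis}^P(a,b)=\{x\in H:\operatorname{dist}^P(a,x)=\operatorname{dist}^P(b,x)\}$. For a facet $F$ of $P$ (the facets are $F_I=\operatorname{conv}\{e_i-e_j:i\in I,j\notin I\}$, $\emptyset\neq I\subsetneq[d]$), $C_F=\operatorname{cone}(F)$, and $\operatorname{bis}^P_{F,G}(a,b)=\operatorname{bis}^P(a,b)\cap(C_F+a)\cap(C_G+b)$. Bisectors $\operatorname{bis}^P(a,b)$ and $\operatorname{bis}^P(a',b')$ are equivalent if for all facets $F,G$: $\operatorname{bis}^P_{F,G}(a,b)\neq\emptyset\Leftrightarrow\operatorname{bis}^P_{F,G}(a',b')\neq\emptyset$. A point $c\in H$ is in general position if there is a neighborhood $U\subseteq H$ of $c$ such that $\operatorname{bis}^P(0,c)$ is equivalent to $\operatorname{bis}^P(0,c')$ for all $c'\in U$. A polyhedral fan $\Delta$ in $H$ is the bisection fan of $P$ if for all $a,b\in H$ in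 general position the following are equivalent: (i) $\operatorname{bis}^P(0,a)$ and $\operatorname{bis}^P(0,b)$ are equivalent; (ii) $a$ and $b$ lie in the interior (relative to $H$) of the same maximal cone of $\Delta$. *)

(* Defs.v *)
From HB Require Import structures.
From mathcomp Require Import all_boot all_order all_algebra.
From mathcomp Require Import all_classical all_reals all_analysis.

Set Implicit Arguments.
Unset Strict Implicit.
Unset Printing Implicit Defensive.

Import Order.TTheory GRing.Theory Num.Theory.
Import numFieldNormedType.Exports.

Local Open Scope classical_set_scope.
Local Open Scope ring_scope.

Section Convex.
Variables (R : realType) (V : lmodType R).
Implicit Types A C F : set V.

Definition conv A : set V :=
  [set x | exists n (v : 'I_n -> V) (c : 'I_n -> R),
    [/\ forall i, A (v i), forall i, 0 <= c i,
        \sum_i c i = 1 & x = \sum_i c i *: v i]].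

Definition cone A : set V :=
  [set x | exists n (v : 'I_n -> V) (c : 'I_n -> R),
    [/\ forall i, A (v i), forall i, 0 <= c i & x = \sum_i c i *: v i]].

(* Faces are nonempty, and C is a face of itself (take l = 0). *)
Definition is_face F C :=
  F !=set0 /\ exists l : {scalar V},
    F = [set x | C x /\ forall y, C y -> l y <= l x].

Definition is_facet F C :=
  [/\ is_face F C, F <> C &
      forall F', is_face F' C -> F' <> C -> F `<=` F' -> F' = F].

Definition common_refinement (D1 D2 : set (set V)) : set (set V) :=
  [set E | exists C1 C2, [/\ D1 C1, D2 C2 & E = C1 `&` C2]].

Definition maximal_cone (D : set (set V)) C :=
  D C /\ forall C', D C' -> C `<=` C' -> C' = C.

End Convex.

Section Hyperplane.
Variables (R : realType) (d : nat).
Local Notation V := 'rV[R]_d.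
Implicit Types (a b c x : V) (I J K : {set 'I_d}).

Definition coordsum x K : R := \sum_(i in K) x 0 i.

Definition H : set V := [set x | coordsum x [set: 'I_d]%SET = 0].

Definition relint (A : set V) : set V :=
  [set x | H x /\ within H (nbhs x) A].

Definition polyhedral_cone (C : set V) :=
  exists n (l : 'I_n -> {scalar V}),
    C = [set x | H x /\ forall i, 0 <= l i x].

Definition polyhedral_fan (D : set (set V)) :=
  [/\ finite_set D,
      forall C, D C -> polyhedral_cone C,
      forall C F, D C -> is_face F C -> D F &
      forall C C', D C -> D C' ->
        is_face (C `&` C') C /\ is_face (C `&` C') C'].

(* For U relatively open in H: the closures of the connected components of U,
   together with all their faces. *)
Definition induced_fan (U : set V) : set (set V) :=
  [set F | exists2 x, U x & is_face F (closure (connected_component U x))].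

Definition linearity_locus (f : V -> R) : set V :=
  [set x | H x /\ exists l : {scalar V},
    \forall y \near within H (nbhs x), f y = l y].

(* The index I = [d] is left out: x([d]) = 0 on all of H. *)
Definition resonance_complement : set V :=
  [set x | H x /\ forall I, I <> finset.set0 -> I <> [set: 'I_d]%SET ->
    coordsum x I <> 0].

Definition resonance_fan : set (set V) := induced_fan resonance_complement.

(* The default value 0 of the two big operators is the member K = set0 of the
   family, so these are the maximum and the minimum of the family itself. *)
Definition f_ I a : R :=
  \big[Num.max/0]_(K : {set 'I_d} | (K \subset I) || (K \subset ~: I)%SET)
    coordsum a K.

Definition g_ I a : R :=
  \big[Num.min/0]_(K : {set 'I_d} | (K \subset I) || (K \subset ~: I)%SET)
    coordsum a K.

Definition p a : R := \sum_(I : {set 'I_d}) (f_ I a + g_ I a).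

Definition linearity_fan : set (set V) := induced_fan (linearity_locus p).

Definition basis_vec (i : 'I_d) : V := delta_mx 0 i.

Definition root_polytope : set V :=
  conv [set v | exists i j : 'I_d, (i < j)%N /\
    (v = basis_vec i - basis_vec j \/ v = - (basis_vec i - basis_vec j))].

Section Bisectors.
Variable P : set V.

(* The minimum of {t >= 0 : b - a in t P}; junk value 0 if there is none. *)
Definition dist a b : R :=
  let S := [set t : R | 0 <= t /\ exists2 v, P v & b - a = t *: v] in
  xget 0 [set t | S t /\ lbound S t].

Definition bis a b : set V := [set x | H x /\ dist a x = dist b x].

Definition bis_facets (F G : set V) a b : set V :=
  bis a b `&` [set x | cone F (x - a)] `&` [set x | cone G (x - b)].

Definition bis_equiv a b a' b' :=
  forall F G, is_facet F P -> is_facet G P ->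
    (bis_facets F G a b !=set0 <-> bis_facets F G a' b' !=set0).

Definition general_position c :=
  H c /\ \forall c' \near within H (nbhs c), bis_equiv 0 c 0 c'.

Definition is_bisection_fan (D : set (set V)) :=
  polyhedral_fan D /\
  forall a b, general_position a -> general_position b ->
    (bis_equiv 0 a 0 b <->
     exists C, [/\ maximal_cone D C, relint C a & relint C b]).

End Bisectors.

End Hyperplane.

Arguments linearity_fan : clear implicits.
Arguments resonance_fan : clear implicits.
Arguments root_polytope : clear implicits.

(* Main.v *)
(* Write x^+ and x^- for the positive and negative parts of x. On H one has
   p(x) = (F(x) - F(-x)) / 2 with F(x) = sum_K |x^+(K) - x^+(~K)|. Although its
   summands are not convex, F is: it is the maximum of the linear functions
   x |-> sum_K s_K (1_K - 1_{~K})(x) over the sign vectors s that make all the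
   coefficients nonnegative, because the coefficient of x_i vanishes for the
   optimal s whenever x_i <= 0. A second difference along e_i - e_j shows that
   the convex kinks of F(x) and the concave kinks of -F(-x) never cancel (except
   for d = 2, where p = 0), so the regions of linearity of p are those of the
   convex function F(x) + F(-x), and hence form a fan; they record the signs of
   x^+(K) - x^+(~K) and of x^-(K) - x^-(~K).

   The cone over the facet F_I is {x >= 0 on I, x <= 0 off I}, on which the
   distance to 0 is x(I) = x^+([d]). Solving for a point of bis_{F_I,F_J}(0,c)
   gives: c >= 0 on I \ J, c <= 0 on J \ I, and moreover
   - c^+(I) >= c^+(~I) and c^-(J) >= c^-(~J) if I and J are disjoint,
   - the same for (~I, ~J, -c) if I and J cover [d],
   - c(J) <= 0 <= c(I) otherwise.
   So the bisector determines, and is determined by, the signs recorded by the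
   common refinement. Finally a fan with the defining property of the bisection
   fan is unique, because points in general position are dense in H. *)

From HB Require Import structures.
Require Import Defs.
From mathcomp Require Import all_boot all_order all_algebra.
From mathcomp Require Import all_classical all_reals all_analysis.
From mathcomp Require Import lra ring.

Set Implicit Arguments.
Unset Strict Implicit.
Unset Printing Implicit Defensive.

Import Order.TTheory GRing.Theory Num.Theory.
Import numFieldNormedType.Exports.

Local Open Scope classical_set_scope.
Local Open Scope ring_scope.

(** * Boxes and components *)

Section Topology.
Variables (R : realType) (d : nat).
Local Notation V := 'rV[R]_d.
Local Notation H := (@H R d).
Implicit Types (x y z u v : V) (A B C F U : set V).

Definition box x e : set V := [set y | forall i, `|y 0 i - x 0 i| < e].

Lemma nbhs_boxP x A :
  nbhs x A <-> exists2 e, 0 < e & box x e `<=` A.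
Proof.
split=> [/nbhs_ballP[e /= e0 sA]|[e e0 sA]]; last apply/nbhs_ballP; exists e => //=.
  move=> y xy; apply: sA; split=> // i j; rewrite ord1 -ball_normE /= distrC.
  exact: xy.
by move=> y [_ xy]; apply: sA => i; have := xy 0 i; rewrite -ball_normE /= distrC.
Qed.

Lemma nearHP x A :
  (\forall y \near within H (nbhs x), A y) <->
  exists2 e, 0 < e & forall y, H y -> box x e y -> A y.
Proof.
rewrite near_withinE; split=> [/nbhs_boxP[e e0 sA]|[e e0 sA]].
  by exists e => // y Hy xy; apply: sA.
by apply/nbhs_boxP; exists e => // y xy Hy; apply: sA.
Qed.

Lemma relintP A x :
  relint A x <-> H x /\ exists2 e, 0 < e & forall y, H y -> box x e y -> A y.
Proof. by split=> -[Hx /nearHP nA]; split. Qed.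

Lemma closureP A x :
  closure A x <-> forall e, 0 < e -> exists2 y, A y & box x e y.
Proof.
split=> [cA e e0|cA B /nbhs_boxP[e e0 sB]].
  have /cA[y [Ay xy]] : nbhs x (box x e) by apply/nbhs_boxP; exists e.
  by exists y.
by have [y Ay xy] := cA e e0; exists y; split=> //; apply: sB.
Qed.

Lemma box_refl x e : 0 < e -> box x e x.
Proof. by move=> e0 i; rewrite subrr normr0. Qed.

Lemma box_trans x y z e f : box x e y -> box y f z -> box x (e + f) z.
Proof.
move=> xy yz i; rewrite (_ : _ - _ = (z 0 i - y 0 i) + (y 0 i - x 0 i)); last by ring.
by rewrite (le_lt_trans (ler_normD _ _))// addrC ltrD.
Qed.

Lemma box_le x e f : e <= f -> box x e `<=` box x f.
Proof. by move=> ef y xy i; apply: lt_le_trans ef. Qed.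

Lemma small_step v e : 0 < e ->
  exists2 t, 0 < t & forall s x, `|s| <= t -> box x e (x + s *: v).
Proof.
move=> e0; pose M := \sum_i `|v 0 i|.
have M0 : 0 <= M by apply: sumr_ge0.
exists (e / (1 + M)); first by rewrite divr_gt0 ?ltr_pwDl.
move=> s x st i; rewrite !mxE addrAC subrr add0r normrM.
have vM : `|v 0 i| <= M by rewrite /M (bigD1 i)//= lerDl sumr_ge0.
have lt1 : `|v 0 i| < 1 + M by lra.
rewrite (le_lt_trans (ler_wpM2r _ st))// -mulrA gtr_pMr//.
by rewrite mulrC ltr_pdivrMr ?mul1r ?ltr_pwDl.
Qed.

(** Lipschitz continuity for the sup norm, phrased with boxes. Sign conditions below are imposed on
    such functions, so openness, closedness and constancy of sign on components are settled once. *)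
Definition lipschitz (h : V -> R) :=
  exists2 M, 0 <= M & forall x y e, box x e y -> `|h y - h x| <= M * e.

Lemma lipschitzN h : lipschitz h -> lipschitz (fun x => - h x).
Proof.
by move=> [M M0 hM]; exists M => // x y e xy; rewrite opprK addrC distrC hM.
Qed.

Lemma lipschitzZ c h : lipschitz h -> lipschitz (fun x => c * h x).
Proof.
move=> [M M0 hM]; exists (`|c| * M); first exact: mulr_ge0.
by move=> x y e /hM hxy; rewrite -mulrBr normrM -mulrA ler_wpM2l.
Qed.

Lemma lipschitz_gt0 h x : lipschitz h -> 0 < h x ->
  exists2 e, 0 < e & forall y, box x e y -> 0 < h y.
Proof.
move=> [M M0 hM] hx; exists (h x / (1 + M)); first by rewrite divr_gt0 ?ltr_pwDl.
move=> y /hM; set e := M * _ => hy.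
have : e < h x by rewrite /e mulrCA gtr_pMr// ltr_pdivrMr ?mul1r ?ltr_pwDl//; lra.
by move: hy; rewrite ler_norml => /andP[]; lra.
Qed.

Lemma open_lipschitz h : lipschitz h -> open [set x | 0 < h x].
Proof.
move=> lh; rewrite openE => x /(lipschitz_gt0 lh)[e e0 he].
by apply/nbhs_boxP; exists e.
Qed.

Lemma closed_lipschitz h : lipschitz h -> closed [set x | 0 <= h x].
Proof.
move=> /lipschitzN lh; rewrite -[X in closed X]setCK; apply: open_closedC.
rewrite (_ : ~` _ = [set x | 0 < - h x]); first exact: open_lipschitz.
by apply/seteqP; split=> x /=; rewrite oppr_gt0 ltNge => /negP.
Qed.

Lemma closed_lipschitz0 h : lipschitz h -> closed [set x | h x = 0].
Proof.
move=> lh.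
rewrite (_ : [set x | h x = 0] = [set x | 0 <= h x] `&` [set x | 0 <= - h x]).
  by apply: closedI; apply: closed_lipschitz => //; apply: lipschitzN.
apply/seteqP; split=> x /=; rewrite oppr_ge0; first by move=> ->.
by move=> [h0 h1]; apply/eqP; rewrite eq_le h1.
Qed.

(** Where [h] has no zero, the sets [h > 0] and [h >= 0] coincide, so this set is both open and
    closed in any connected subset of [U]. *)
Lemma component_lipschitz U h x : lipschitz h -> (forall y, U y -> h y != 0) ->
  0 < h x -> connected_component U x `<=` [set y | 0 < h y].
Proof.
move=> lh h0 hx y [B [Bx BU cB] By].
suff BE : B `&` [set z | 0 < h z] = B by move: By; rewrite -{1}BE => -[].
apply: cB; first by exists x.
  by exists [set y | 0 < h y] => //; apply: open_lipschitz.
exists [set y | 0 <= h y]; first exact: closed_lipschitz.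
apply/seteqP; split=> z /= [Bz]; first by move/ltW.
by rewrite le_eqVlt eq_sym (negbTE (h0 _ (BU _ Bz))).
Qed.

Lemma component_segment U x y :
  (forall t, 0 <= t <= 1 -> U (x + t *: (y - x))) -> connected_component U x y.
Proof.
move=> sU; pose f (t : R) : V := x + t *: (y - x).
exists (f @` `[0, 1]); last first.
  by exists 1; [rewrite /= in_itv/= ler01 lexx|rewrite /f scale1r addrC subrK].
split=> [||].
- by exists 0; [rewrite /= in_itv/= ler01 lexx|rewrite /f scale0r addr0].
- by move=> _ [t /= t01 <-]; apply: sU; move: t01; rewrite in_itv.
apply: connected_continuous_connected; first exact: segment_connected.
apply: continuous_subspaceT => t A /nbhs_boxP[e e0 sA].
have [s s0 hs] := small_step (y - x) e0.
apply/nbhs_ballP; exists s => //= u; rewrite -ball_normE /= => /ltW tu.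
apply: sA; rewrite /f (_ : x + u *: (y - x) = x + t *: (y - x) + (u - t) *: (y - x)).
  by apply: hs; rewrite distrC.
by rewrite -addrA -scalerDl [t + _]addrCA subrr addr0.
Qed.

End Topology.

(** * Polyhedral cones *)

Section Dot.
Variables (R : realType) (d : nat).
Local Notation V := 'rV[R]_d.
Implicit Types (v x y : V).

Definition dot v x : R := \sum_i v 0 i * x 0 i.

Lemma dotDr v : {morph dot v : x y / x + y}.
Proof.
by move=> x y; rewrite /dot -big_split/=; apply: eq_bigr => i _; rewrite mxE mulrDr.
Qed.

Lemma dotZr v a x : dot v (a *: x) = a * dot v x.
Proof. by rewrite /dot mulr_sumr; apply: eq_bigr => i _; rewrite mxE mulrCA. Qed.

Lemma dotC v x : dot v x = dot x v.
Proof. by apply: eq_bigr => i _; rewrite mulrC. Qed.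

Lemma dotDl x v w : dot (v + w) x = dot v x + dot w x.
Proof. by rewrite !(dotC _ x) dotDr. Qed.

Lemma dotZl x a v : dot (a *: v) x = a * dot v x.
Proof. by rewrite !(dotC _ x) dotZr. Qed.

Lemma dotNl x v : dot (- v) x = - dot v x.
Proof. by rewrite -scaleN1r dotZl mulN1r. Qed.

Lemma dotNr v x : dot v (- x) = - dot v x.
Proof. by rewrite dotC dotNl dotC. Qed.

Lemma dotBl x v w : dot (v - w) x = dot v x - dot w x.
Proof. by rewrite dotDl dotNl. Qed.

Lemma dotBr v x y : dot v (x - y) = dot v x - dot v y.
Proof. by rewrite dotDr dotNr. Qed.

Lemma dot0l x : dot 0 x = 0.
Proof. by rewrite -(scale0r 0) dotZl mul0r. Qed.

Lemma dot0r v : dot v 0 = 0.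
Proof. by rewrite dotC dot0l. Qed.

Lemma dot_suml (T : finType) (P : pred T) (w : T -> V) x :
  dot (\sum_(t | P t) w t) x = \sum_(t | P t) dot (w t) x.
Proof.
apply: (big_morph (fun v => dot v x)) => [v1 v2|]; by rewrite ?dotDl ?dot0l.
Qed.

Lemma dot_sumr (T : finType) (P : pred T) v (w : T -> V) :
  dot v (\sum_(t | P t) w t) = \sum_(t | P t) dot v (w t).
Proof. by rewrite dotC dot_suml; apply: eq_bigr => t _; rewrite dotC. Qed.

Lemma dot_delta v i : dot v (delta_mx 0 i) = v 0 i.
Proof.
rewrite /dot (bigD1 i)//= mxE !eqxx mulr1 big1 ?addr0// => j /negbTE ji.
by rewrite mxE eqxx ji mulr0.
Qed.

Lemma dot_is_linear v : linear_for *%R (dot v).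
Proof. by move=> a x y; rewrite dotDr dotZr. Qed.

HB.instance Definition _ v :=
  GRing.isLinear.Build R V R *%R (dot v) (dot_is_linear v).

Lemma scalar_dot (l : {scalar V}) : exists v, forall x, l x = dot v x.
Proof.
exists (\row_i l (delta_mx 0 i)) => x.
rewrite {1}(row_sum_delta x) linear_sum; apply: eq_bigr => i _.
by rewrite linearZ mxE mulrC.
Qed.

Lemma lipschitz_dot v : lipschitz (dot v).
Proof.
exists (\sum_i `|v 0 i|); first exact: sumr_ge0.
move=> x y e xy; rewrite -dotBr /dot (le_trans (ler_norm_sum _ _ _))//.
rewrite mulr_suml ler_sum// => i _; rewrite normrM !mxE ler_wpM2l//.
exact: ltW (xy i).
Qed.

Lemma H_dot x : H x <-> dot (const_mx 1) x = 0.
Proof.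
rewrite /H /coordsum /dot /= (eq_bigl xpredT) => [|i]; last by rewrite inE.
by under [in X in _ <-> X]eq_bigr do rewrite mxE mul1r.
Qed.

Lemma H0 : H (0 : V).
Proof. by apply/H_dot; rewrite dot0r. Qed.

Lemma HD x y : H x -> H y -> H (x + y).
Proof. by move=> /H_dot Hx /H_dot Hy; apply/H_dot; rewrite dotDr Hx Hy addr0. Qed.

Lemma HZ a x : H x -> H (a *: x).
Proof. by move=> /H_dot Hx; apply/H_dot; rewrite dotZr Hx mulr0. Qed.

Lemma HN x : H x -> H (- x).
Proof. by rewrite -scaleN1r; apply: HZ. Qed.

Lemma HB x y : H x -> H y -> H (x - y).
Proof. by move=> Hx Hy; apply: HD => //; apply: HN. Qed.

Lemma closed_H : closed (@H R d).
Proof.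
rewrite (_ : @H R d = [set x | dot (const_mx 1) x = 0]).
  exact/closed_lipschitz0/lipschitz_dot.
by apply/seteqP; split=> x /H_dot.
Qed.

End Dot.

(** * Faces of polyhedral cones *)

Section Cones.
Variables (R : realType) (d : nat).
Local Notation V := 'rV[R]_d.
Local Notation H := (@H R d).
Implicit Types (x y z u v : V) (A B C F G : set V).

(** Indexing by an arbitrary finite type lets sum types describe intersections and added
    constraints. *)
Definition halfspaces (T : finType) (l : T -> V) : set V :=
  [set x | H x /\ forall t, 0 <= dot (l t) x].

Lemma polyhedral_halfspaces (T : finType) (l : T -> V) :
  polyhedral_cone (halfspaces l).
Proof.
exists #|T|, (fun i => dot (l (enum_val i)) : {scalar V}).
apply/seteqP; split=> x /= [Hx lx]; split=> // t.
by have := lx (enum_rank t); rewrite enum_rankK.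
Qed.

Lemma polyhedral_coneP C :
  polyhedral_cone C -> exists n (l : 'I_n -> V), C = halfspaces l.
Proof.
move=> [n [l ->]]; have [v lv] := choice (fun i => scalar_dot (l i)).
exists n, v; apply/seteqP; split=> x [Hx lx]; split=> // i.
  by rewrite -lv.
by rewrite lv.
Qed.

Lemma halfspaces0 (T : finType) (l : T -> V) : halfspaces l 0.
Proof. by split=> [|t]; [apply: H0|rewrite dot0r]. Qed.

Lemma halfspacesD (T : finType) (l : T -> V) x y :
  halfspaces l x -> halfspaces l y -> halfspaces l (x + y).
Proof.
by move=> [Hx lx] [Hy ly]; split=> [|t]; [apply: HD|rewrite dotDr addr_ge0].
Qed.

Lemma halfspacesZ (T : finType) (l : T -> V) a x :
  0 <= a -> halfspaces l x -> halfspaces l (a *: x).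
Proof.
by move=> a0 [Hx lx]; split=> [|t]; [apply: HZ|rewrite dotZr mulr_ge0].
Qed.

Lemma halfspaces_closed (T : finType) (l : T -> V) : closed (halfspaces l).
Proof.
rewrite (_ : halfspaces l =
    H `&` \bigcap_(t in [set: T]) [set x | 0 <= dot (l t) x]).
  apply: closedI; first exact: closed_H.
  by apply: closed_bigI => t _; apply/closed_lipschitz/lipschitz_dot.
by apply/seteqP; split=> x [Hx lx]; split=> // t; [move=> _|]; apply: lx.
Qed.

Lemma polyhedral_closed C : polyhedral_cone C -> closed C.
Proof. by move=> /polyhedral_coneP[n [l ->]]; apply: halfspaces_closed. Qed.

Lemma polyhedral0 C : polyhedral_cone C -> C 0.
Proof. by move=> /polyhedral_coneP[n [l ->]]; apply: halfspaces0. Qed.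

Lemma polyhedralD C x y : polyhedral_cone C -> C x -> C y -> C (x + y).
Proof. by move=> /polyhedral_coneP[n [l ->]]; apply: halfspacesD. Qed.

Lemma polyhedralZ C a x : polyhedral_cone C -> 0 <= a -> C x -> C (a *: x).
Proof. by move=> /polyhedral_coneP[n [l ->]]; apply: halfspacesZ. Qed.

Lemma polyhedral_subH C : polyhedral_cone C -> C `<=` H.
Proof. by move=> /polyhedral_coneP[n [l ->]] x []. Qed.

Lemma polyhedralI C C' :
  polyhedral_cone C -> polyhedral_cone C' -> polyhedral_cone (C `&` C').
Proof.
move=> /polyhedral_coneP[n [l ->]] /polyhedral_coneP[n' [l' ->]].
rewrite (_ : _ `&` _ = halfspaces (fun s : 'I_n + 'I_n' =>
    match s with inl i => l i | inr i => l' i end)).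
  exact: polyhedral_halfspaces.
apply/seteqP; split=> x /=.
  by move=> [[Hx lx] [_ lx']]; split=> // -[].
by move=> [Hx lx]; split; split=> // i; [apply: (lx (inl i))|apply: (lx (inr i))].
Qed.

(** On a cone a functional can attain its maximum only with the value 0, so faces are cut out by
    functionals that are nonpositive on the cone. *)
Lemma is_faceP C F : polyhedral_cone C ->
  is_face F C <-> exists v, (forall y, C y -> dot v y <= 0) /\
    F = [set x | C x /\ dot v x = 0].
Proof.
move=> pC; split=> [[[x Fx] [l FE]]|[v [vC FE]]]; last first.
  split; first by exists 0; rewrite FE /= dot0r; split=> //; apply: polyhedral0.
  exists (dot v); rewrite FE; apply/seteqP; split=> x /= [Cx vx]; split=> //.
    by move=> y Cy; rewrite vx vC.
  apply/eqP; rewrite eq_le vC//=; apply: le_trans (vx 0 (polyhedral0 pC)).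
  by rewrite dot0r.
have [v lv] := scalar_dot l; exists v.
move: Fx; rewrite FE => -[Cx lx].
have x0 : dot v x = 0.
  (* Comparing [x] with [2 *: x] and with 0 forces the maximal value to be 0. *)
  have := lx (2 *: x); rewrite !lv dotZr => /(_ (polyhedralZ pC _ Cx)).
  have := lx 0 (polyhedral0 pC); rewrite !lv dot0r => h1 h2.
  by have := h2 ltac:(lra); lra.
split=> [y Cy|]; first by rewrite -x0 -!lv; apply: lx.
apply/seteqP; split=> y /= [Cy ly]; split=> //.
  by have := lx y Cy; have := ly x Cx; rewrite !lv x0; lra.
by move=> w Cw; rewrite [l y]lv ly -x0 -lv lx.
Qed.

Lemma face_sub F C : is_face F C -> F `<=` C.
Proof. by move=> [_ [l ->]] x []. Qed.

Lemma face_refl C : polyhedral_cone C -> is_face C C.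
Proof.
move=> pC; apply/(is_faceP _ pC); exists 0.
split=> [y _|]; first by rewrite dot0l.
by apply/seteqP; split=> x /= => [Cx|[]]//; rewrite dot0l.
Qed.

Lemma face_polyhedral F C : polyhedral_cone C -> is_face F C -> polyhedral_cone F.
Proof.
move=> pC /(is_faceP _ pC)[v [vC ->]].
rewrite (_ : mkset _ = C `&` halfspaces (fun _ : unit => v)).
  exact/polyhedralI/polyhedral_halfspaces.
apply/seteqP; split=> x /=.
  by move=> [Cx vx]; split=> //; split=> [|_]; [apply: polyhedral_subH Cx|rewrite vx].
move=> [Cx [_ /(_ tt) vx]]; split=> //.
by apply/eqP; rewrite eq_le vC.
Qed.

Lemma faceI F G C : polyhedral_cone C -> is_face F C -> is_face G C ->
  is_face (F `&` G) C.
Proof.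
move=> pC /(is_faceP _ pC)[v [vC ->]] /(is_faceP _ pC)[w [wC ->]].
apply/(is_faceP _ pC); exists (v + w); split=> [y Cy|].
  by rewrite dotDl; have := vC y Cy; have := wC y Cy; lra.
apply/seteqP; split=> x /=; rewrite dotDl.
  by move=> [[Cx ->] [_ ->]]; rewrite addr0.
by move=> [Cx e]; have := vC x Cx; have := wC x Cx; split; split=> //; lra.
Qed.

Lemma face_setI F G C : polyhedral_cone C -> polyhedral_cone G ->
  is_face F C -> is_face (F `&` G) (C `&` G).
Proof.
move=> pC pG /(is_faceP _ pC)[v [vC ->]].
apply/(is_faceP _ (polyhedralI pC pG)); exists v.
split=> [y [Cy _]|]; first exact: vC.
by apply/seteqP; split=> x /= [[? ?] ?].
Qed.

(* For a polyhedral cone: z is interior to C relative to the span of C, whereas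
   [relint] is relative to H. *)
Definition absorbs C z := C z /\ forall y, C y -> exists2 e, 0 < e & C (z - e *: y).

(** The supporting functional [v] vanishes at [z]; evaluating it at [z - e *: y] gives
    [0 <= dot v y], so it vanishes on all of [C]. *)
Lemma absorbs_face C F z : polyhedral_cone C -> absorbs C z ->
  is_face F C -> F z -> F = C.
Proof.
move=> pC [Cz az] /(is_faceP _ pC)[v [vC ->]] [_ vz].
apply/seteqP; split=> [x []//|y Cy] /=; split=> //.
have [e e0 /vC] := az y Cy; rewrite dotBr vz dotZr sub0r oppr_le0 pmulr_rge0//.
by move=> vy; apply/eqP; rewrite eq_le vC.
Qed.

(** Only the constraints tight at [z] restrict the direction [y]; the others have slack, and there
    are finitely many. *)
Lemma halfspaces_subtract (T : finType) (l : T -> V) z y : halfspaces l z -> H y ->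
  (forall t, dot (l t) z = 0 -> dot (l t) y <= 0) ->
  exists2 e, 0 < e & halfspaces l (z - e *: y).
Proof.
(* [M] bounds every ratio; a tight constraint contributes 0, since division by 0 gives 0. *)
move=> [Hz lz] Hy lzy; pose M := \sum_t `|dot (l t) y / dot (l t) z|.
have M0 : 0 <= M by apply: sumr_ge0.
exists (1 + M)^-1; first by rewrite invr_gt0 ltr_pwDl.
split=> [|t]; first exact/HB/HZ.
rewrite dotBr dotZr subr_ge0 ler_pdivrMl ?ltr_pwDl//.
have [z0|z0] := eqVneq (dot (l t) z) 0; first by rewrite z0 mulr0 lzy.
have zp : 0 < dot (l t) z by rewrite lt_neqAle eq_sym z0 lz.
rewrite -ler_pdivrMr// (le_trans (ler_norm _))//.
by rewrite /M (bigD1 t)//= addrCA lerDl addr_ge0// sumr_ge0.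
Qed.

(* Summing, for each t, a point of F where l t does not vanish. *)
Lemma strict_point (T : finType) (l : T -> V) F : F 0 ->
  (forall x y, F x -> F y -> F (x + y)) ->
  (forall x t, F x -> 0 <= dot (l t) x) ->
  exists2 z, F z & forall t, dot (l t) z = 0 -> forall y, F y -> dot (l t) y = 0.
Proof.
move=> F0 FD Fl.
have /choice[z zP] : forall t, exists z, F z /\
    (dot (l t) z = 0 -> forall y, F y -> dot (l t) y = 0).
  move=> t; have [[y [Fy ly]]|nex] := pselect (exists y, F y /\ dot (l t) y <> 0).
    by exists y.
  exists 0; split=> // _ y Fy; apply: contrapT => ly; apply: nex.
  by exists y.
have Fz t : F (z t) by case: (zP t).
exists (\sum_t z t); first by elim/big_ind: _.
move=> t; rewrite dot_sumr => z0; apply: (zP t).2.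
by apply: (psumr_eq0P _ z0) => // s _; apply: Fl.
Qed.

Lemma polyhedral_absorbs C : polyhedral_cone C -> exists z, absorbs C z.
Proof.
move=> pC; have /polyhedral_coneP[n [l CE]] := pC.
have [||x t|z Cz lz] := @strict_point _ l C.
- exact: polyhedral0.
- by move=> x y; apply: polyhedralD.
- by rewrite CE => -[].
exists z; split=> // y Cy; rewrite CE; apply: halfspaces_subtract.
- by rewrite -CE.
- exact: polyhedral_subH Cy.
- by move=> t /lz ->.
Qed.

(** Faces are obtained by making some of the inequalities tight. Given [F], take [A] to be the
    constraints tight at a point [z] of [F] that is as strict as possible: if [x] satisfies [A] with
    equality, then [z - e *: x] stays in the cone, and the supporting functional must vanish at [x].
    Conversely, minus the sum of the tight forms is a supporting functional. *)
Lemma face_active (T : finType) (l : T -> V) F :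
  is_face F (halfspaces l) <-> exists A : {set T},
    F = [set x | halfspaces l x /\ forall t, t \in A -> dot (l t) x = 0].
Proof.
have pC := polyhedral_halfspaces l; split=> [fF|[A ->]]; last first.
  apply/(is_faceP _ pC); exists (- \sum_(t in A) l t); split=> [y [_ ly]|].
    by rewrite dotNl oppr_le0 dot_suml sumr_ge0.
  apply/seteqP; split=> x /= [[Hx lx] Ax]; split=> //.
    by rewrite dotNl dot_suml big1 ?oppr0.
  move=> t tA; apply: (psumr_eq0P (P := mem A) (F := fun t => dot (l t) x)) => //.
  by apply/eqP; rewrite -oppr_eq0 -dot_suml -dotNl Ax.
have pF := face_polyhedral pC fF; have sF := face_sub fF.
have [||x t|z Fz lz] := @strict_point _ l F.
- exact: polyhedral0.
- by move=> x y; apply: polyhedralD.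
- by move=> /sF[].
exists [set t | dot (l t) z == 0]%SET.
apply/seteqP; split=> x /= => [Fx|[Cx xA]].
  by split=> [|t]; [apply: sF|rewrite inE => /eqP/lz; apply].
have [e e0 Ce] : exists2 e, 0 < e & halfspaces l (z - e *: x).
  apply: halfspaces_subtract; [exact: sF|by case: Cx|].
  by move=> t /eqP lt0; rewrite xA ?inE.
move: fF Fz => /(is_faceP _ pC)[v [vC ->]] [_ vz]; split=> //.
have := vC _ Ce; rewrite dotBr vz dotZr sub0r oppr_le0 pmulr_rge0// => vx.
by apply/eqP; rewrite eq_le vC.
Qed.

Lemma faces_finite C : polyhedral_cone C -> finite_set [set F | is_face F C].
Proof.
move=> /polyhedral_coneP[n [l ->]].
pose g (A : {set 'I_n}) :=
  [set x | halfspaces l x /\ forall t, t \in A -> dot (l t) x = 0].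
apply: (@sub_finite_set _ _ (g @` [set: {set 'I_n}])).
  by move=> F /face_active[A ->]; exists A.
exact: finite_image.
Qed.

Lemma face_trans C F G : polyhedral_cone C -> is_face F C -> is_face G F ->
  is_face G C.
Proof.
move=> /polyhedral_coneP[n [l ->]] /face_active[A ->].
(* The equalities in [A] become opposite pairs of inequalities; indices outside [A] get the void
   constraint 0. *)
rewrite (_ : mkset _ = halfspaces (fun s : 'I_n + 'I_n => match s with
    inl i => l i | inr i => if i \in A then - l i else 0 end)); last first.
  apply/seteqP; split=> x /=.
    move=> [[Hx lx] Ax]; split=> // -[] i //=.
    by case: ifPn => [/Ax|_]; rewrite ?dot0l// dotNl => ->; rewrite oppr0.
  move=> [Hx lx]; split; first by split=> // i; apply: (lx (inl i)).
  move=> t tA; have := lx (inl t); have := lx (inr t).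
  by rewrite /= tA dotNl oppr_ge0 => ? ?; apply/eqP; rewrite eq_le; apply/andP.
move=> /face_active[B ->]; apply/face_active.
(* The added constraints vanish on [F] anyway, so only the original ones active in [B] count. *)
exists (A :|: [set i | inl i \in B])%SET.
apply/seteqP; split=> x /=.
  move=> [[Hx lx] Bx]; split; first by split=> // i; apply: (lx (inl i)).
  move=> t; rewrite !inE => /orP[tA|/Bx//].
  have := lx (inl t); have := lx (inr t).
  by rewrite /= tA dotNl oppr_ge0 => ? ?; apply/eqP; rewrite eq_le; apply/andP.
move=> [[Hx lx] ABx]; split.
  split=> // -[] i //=; case: ifPn => [iA|_]; rewrite ?dot0l// dotNl ABx ?oppr0//.
  by rewrite inE iA.
move=> [] i iB /=; first by rewrite ABx// !inE iB orbT.
by case: ifPn => [iA|_]; rewrite ?dot0l// dotNl ABx ?oppr0// inE iA.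
Qed.

Lemma face_between F C G : polyhedral_cone C -> polyhedral_cone G ->
  is_face F C -> F `<=` G -> G `<=` C -> is_face F G.
Proof.
move=> pC pG fF FG GC; have := face_setI pC pG fF.
by rewrite (setIidl FG) (setIidr GC).
Qed.

Lemma face_of_setI C C' F : polyhedral_cone C -> polyhedral_cone C' ->
  is_face F (C `&` C') -> exists F1 F2,
    [/\ is_face F1 C, is_face F2 C' & F = F1 `&` F2].
Proof.
move=> /polyhedral_coneP[n [l ->]] /polyhedral_coneP[n' [l' ->]].
rewrite (_ : _ `&` _ = halfspaces (fun s : 'I_n + 'I_n' =>
    match s with inl i => l i | inr i => l' i end)); last first.
  apply/seteqP; split=> x /=.
    by move=> [[Hx lx] [_ lx']]; split=> // -[].
  by move=> [Hx lx]; split; split=> // i; [apply: (lx (inl i))|apply: (lx (inr i))].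
move=> /face_active[A ->].
exists [set x | halfspaces l x /\ forall i, inl i \in A -> dot (l i) x = 0].
exists [set x | halfspaces l' x /\ forall i, inr i \in A -> dot (l' i) x = 0].
split.
- apply/face_active; exists [set i | inl i \in A]%SET.
  by apply/seteqP; split=> x /= [lx Ax]; split=> // t; [rewrite inE|]; have := Ax t; rewrite ?inE.
- apply/face_active; exists [set i | inr i \in A]%SET.
  by apply/seteqP; split=> x /= [lx Ax]; split=> // t; [rewrite inE|]; have := Ax t; rewrite ?inE.
apply/seteqP; split=> x /=.
  move=> [[Hx lx] Ax]; split; split.
  - by split=> // i; apply: (lx (inl i)).
  - by move=> i /Ax.
  - by split=> // i; apply: (lx (inr i)).
  - by move=> i /Ax.
move=> [[[Hx lx] Ax] [[_ lx'] Ax']]; split; first by split=> // -[].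
by move=> [] i; [apply: Ax|apply: Ax'].
Qed.

End Cones.

(** * Fans *)

Section Fans.
Variables (R : realType) (d : nat).
Local Notation V := 'rV[R]_d.
Local Notation H := (@H R d).
Implicit Types (x y z u v : V) (A B C F G U : set V) (D : set (set V)).

Lemma relint_sub C : relint C `<=` C.
Proof. by move=> x /relintP[Hx [e e0]]; apply=> //; apply: box_refl. Qed.

Lemma relintI A B x : relint (A `&` B) x <-> relint A x /\ relint B x.
Proof.
rewrite !relintP; split=> [[Hx [e e0 sAB]]|[[Hx [e e0 sA]] [_ [f f0 sB]]]].
  by split; split=> //; exists e => // y Hy /(sAB y Hy)[].
split=> //; exists (Num.min e f); first by rewrite lt_min e0.
move=> y Hy xy; split; [apply: sA|apply: sB] => //; apply: box_le xy.
  by rewrite ge_min lexx.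
by rewrite ge_min lexx orbT.
Qed.

Lemma relint_open A x : relint A x ->
  exists2 e, 0 < e & forall y, H y -> box x e y -> relint A y.
Proof.
move=> /relintP[Hx [e e0 sA]]; have e2 : 0 < e / 2 by lra.
exists (e / 2) => // y Hy xy; apply/relintP; split=> //; exists (e / 2) => //.
by move=> z Hz yz; apply: sA => //; have := box_trans xy yz; rewrite -splitr.
Qed.

Lemma relint_subtract A x y : relint A x -> H y ->
  exists2 e, 0 < e & A (x - e *: y).
Proof.
move=> /relintP[Hx [e e0 sA]] Hy; have [t t0 ht] := small_step y e0.
exists t => //; apply: sA; first exact/HB/HZ.
by rewrite -scaleNr; apply: ht; rewrite normrN gtr0_norm.
Qed.

Lemma relint_absorbs C x : polyhedral_cone C -> relint C x -> absorbs C x.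
Proof.
move=> pC rx; split=> [|y Cy]; first exact: relint_sub.
by apply: relint_subtract => //; apply: polyhedral_subH Cy.
Qed.

(** If [z] is close to [y + t *: x], then [t^-1 *: (z - y)] is close to [x], hence lies in [C]. *)
Lemma relintD C x y t : polyhedral_cone C -> C y -> relint C x -> 0 < t ->
  relint C (y + t *: x).
Proof.
move=> pC Cy /relintP[Hx [e e0 sC]] t0; have Hy := polyhedral_subH pC Cy.
apply/relintP; split; first exact/HD/HZ.
exists (t * e); first exact: mulr_gt0.
move=> z Hz yz; rewrite (_ : z = y + t *: (t^-1 *: (z - y))); last first.
  by rewrite scalerA divff ?gt_eqF// scale1r addrC subrK.
apply: polyhedralD => //; apply: polyhedralZ => //; first exact: ltW.
apply: sC => [|i]; first exact/HZ/HB.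
have := yz i; rewrite !mxE => h.
rewrite (_ : _ - _ = t^-1 * (z 0 i - (y 0 i + t * x 0 i))); last first.
  by field; rewrite gt_eqF.
by rewrite normrM gtr0_norm ?invr_gt0// mulrC ltr_pdivrMr// [e * t]mulrC.
Qed.

Lemma closure_relint C x : polyhedral_cone C -> relint C x ->
  closure (relint C) = C.
Proof.
move=> pC rx; apply/seteqP; split=> [y cy|y Cy].
  apply: (polyhedral_closed pC); apply: closureS cy; exact: relint_sub.
apply/closureP => e e0; have [t t0 ht] := small_step x e0.
exists (y + t *: x); first exact: relintD.
by apply: ht; rewrite gtr0_norm.
Qed.

Lemma relint_segment C x y t : polyhedral_cone C -> relint C x -> relint C y ->
  0 <= t <= 1 -> relint C (x + t *: (y - x)).
Proof.
move=> pC rx ry /andP[t0 t1].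
have [->|tn0] := eqVneq t 0; first by rewrite scale0r addr0.
rewrite (_ : _ + _ = (1 - t) *: x + t *: y); last first.
  by apply/rowP => i; rewrite !mxE; ring.
apply: relintD => //; last by rewrite lt_neqAle eq_sym tn0.
by apply: polyhedralZ => //; [rewrite subr_ge0|apply: relint_sub].
Qed.

(** The face [C]&[C'] of [C] contains an interior point of [C], so it is all of [C]. *)
Lemma fan_meet_eq D C C' x : polyhedral_fan D -> D C -> D C' ->
  relint C x -> C' x -> C `<=` C'.
Proof.
move=> [_ pD _ DI] DC DC' rx C'x.
have [fC _] := DI _ _ DC DC'.
suff <- : C `&` C' = C by move=> y [].
have CC := absorbs_face (pD _ DC) (relint_absorbs (pD _ DC) rx) fC.
apply: CC.
by split=> //; apply: relint_sub.
Qed.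

Lemma fan_maximal D C x : polyhedral_fan D -> D C -> relint C x ->
  maximal_cone D C.
Proof.
move=> fD DC rx; split=> // C' DC' CC'; have [_ pD _ DI] := fD.
have C'x : relint C' x.
  move: rx => /relintP[Hx [e e0 sC]]; apply/relintP; split=> //.
  by exists e => // y Hy xy; apply/CC'/sC.
apply/seteqP; split=> //; apply: (fan_meet_eq fD DC' DC C'x); apply: relint_sub rx.
Qed.

Lemma common_refinement_fan D1 D2 : polyhedral_fan D1 -> polyhedral_fan D2 ->
  polyhedral_fan (common_refinement D1 D2).
Proof.
move=> [fin1 p1 f1 i1] [fin2 p2 f2 i2]; split.
- have fin12 := finite_image (fun C : set V * set V => C.1 `&` C.2)
    (finite_setX fin1 fin2).
  apply: sub_finite_set fin12 => E [C1 [C2 [? ? ->]]].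
  by exists (C1, C2).
- by move=> E [C1 [C2 [/p1 ? /p2 ? ->]]]; apply: polyhedralI.
- move=> E F [C1 [C2 [D1C D2C ->]]] /face_of_setI[||F1 [F2 [fF1 fF2 ->]]].
  + exact: p1.
  + exact: p2.
  + by exists F1, F2; split=> //; [apply: f1 D1C fF1|apply: f2 D2C fF2].
move=> _ _ [C1 [C2 [D1C D2C ->]]] [C1' [C2' [D1C' D2C' ->]]].
have [a1 b1] := i1 _ _ D1C D1C'; have [a2 b2] := i2 _ _ D2C D2C'.
have ac : forall A B A' B', is_face (A `&` A') A -> is_face (B `&` B') B ->
    polyhedral_cone A -> polyhedral_cone B ->
    is_face (A `&` B `&` (A' `&` B')) (A `&` B).
  move=> A B A' B' fA fB pA pB; rewrite setIACA.
  have := faceI (polyhedralI pA pB) (face_setI pA pB fA)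
    (eq_ind _ (is_face _) (face_setI pB pA fB) _ (setIC B A)).
  set X := _ `&` _; set Y := _ `&` (_ `&` _); suff -> : X = Y by [].
  by apply/seteqP; split=> x; rewrite /X /Y /=; tauto.
split; first by apply: ac; [| |apply: p1|apply: p2].
rewrite setIC; apply: ac; [| |exact: p1|exact: p2].
  by rewrite setIC.
by rewrite setIC.
Qed.

(** The part of H on which the convex function [max_k dot (q k)] is given by its piece [q j]. Both
    fans are described through such regions. *)
Definition max_region (J : finType) (q : J -> V) (j : J) : set V :=
  [set x | H x /\ forall k, dot (q k) x <= dot (q j) x].

Lemma max_region_polyhedral (J : finType) (q : J -> V) j :
  polyhedral_cone (max_region q j).
Proof.
rewrite (_ : max_region q j = halfspaces (fun k => q j - q k)).
  exact: polyhedral_halfspaces.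
by apply/seteqP; split=> x [Hx qx]; split=> // k;
  have := qx k; rewrite dotBl subr_ge0.
Qed.

Lemma max_region_meet (J : finType) (q : J -> V) j k :
  is_face (max_region q j `&` max_region q k) (max_region q j).
Proof.
apply/is_faceP; first exact: max_region_polyhedral.
exists (q k - q j); split=> [y [_ qy]|]; first by rewrite dotBl subr_le0.
apply/seteqP; split=> x /=; rewrite dotBl.
  by move=> [[Hx qj] [_ qk]]; split=> //; have := qj k; have := qk j; lra.
move=> [[Hx qj] e]; split=> //; split=> // i.
by rewrite (le_trans (qj i))//; lra.
Qed.

(** Regions of a maximum of linear functions meet along common faces, so the fan axioms hold once
    every closed component is such a region. *)
Lemma induced_fan_max_region (J : finType) (q : J -> V) U :
  (forall x, U x -> exists j, closure (connected_component U x) = max_region q j) ->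
  polyhedral_fan (induced_fan U).
Proof.
move=> Uq; have pq := max_region_polyhedral q.
have Dq F : induced_fan U F -> exists j, is_face F (max_region q j) /\
    forall G, is_face G (max_region q j) -> induced_fan U G.
  move=> [x Ux fF]; have [j jE] := Uq x Ux; exists j; rewrite -jE.
  by split=> // G fG; exists x.
split.
- apply: (@sub_finite_set _ _ (\bigcup_(j in [set: J]) [set F | is_face F (max_region q j)])).
    by move=> F /Dq[j [fF _]]; exists j.
  by apply: bigcup_finite => // j _; apply: faces_finite.
- by move=> F /Dq[j [fF _]]; apply: face_polyhedral fF.
- by move=> C F /Dq[j [fC jU]] fF; apply: jU; apply: face_trans fC fF.
have meet C C' : induced_fan U C -> induced_fan U C' -> is_face (C `&` C') C.
  move=> /Dq[j [fC _]] /Dq[k [fC' _]].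
  have pC := face_polyhedral (pq j) fC.
  apply: face_between (pq j) pC _ _ (face_sub fC); last by move=> x [].
  (* Each of the two factors is a face of the intersection of the regions [j] and [k], which is
     itself a face of the region [j]. *)
  have E : C `&` C' = (C `&` max_region q k) `&` (C' `&` max_region q j).
    apply/seteqP; split=> x; last by case=> -[? _] [].
    by move=> [Cx C'x]; split; split=> //; [apply: face_sub C'x|apply: face_sub Cx].
  have fjk := max_region_meet q j k.
  apply: face_trans (pq j) fjk _; rewrite E; apply: faceI.
  - exact: polyhedralI.
  - exact: face_setI.
  - by rewrite setIC [X in is_face _ X]setIC setIC; apply: face_setI.
by move=> C C' DC DC'; split; [apply: meet|rewrite setIC; apply: meet].
Qed.

(** The interior of the region is convex, hence contained in one component. Conversely the functions
    [h i] keep their signs on a component, and these signs determine the region. *)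
Lemma component_max_region (J I : finType) (q : J -> V) j (h : I -> V -> R) U x :
  U x -> relint (max_region q j) x -> relint (max_region q j) `<=` U ->
  (forall i, lipschitz (h i)) -> (forall i y, U y -> h i y != 0) ->
  (forall y, U y -> (forall i, 0 < h i x * h i y) -> relint (max_region q j) y) ->
  closure (connected_component U x) = max_region q j.
Proof.
move=> Ux rx rU lh h0 hU; have pq := max_region_polyhedral q j.
rewrite -(closure_relint pq rx); congr closure; apply/seteqP; split=> y; last first.
  by move=> ry; apply: component_segment => t t01; apply/rU/relint_segment.
move=> cy; apply: hU => [|i]; first exact: connected_component_sub cy.
have lhi := lipschitzZ (h i x) (lh i).
apply: (component_lipschitz lhi _ _ cy) => [z Uz|].
  by rewrite mulf_neq0 ?h0.
by rewrite -expr2 exprn_even_gt0//= h0.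
Qed.

(** * Uniqueness of the bisection fan when points in general position are dense *)

Section Uniqueness.
Variable P : set V.
Hypothesis gp_dense : forall x e, H x -> 0 < e ->
  exists2 y, general_position P y & box x e y.

(** The right-hand side does not mention [D]: a maximal cone with a point in general position in its
    interior is determined by [P] alone. *)
Lemma maximal_cone_closure D C a : is_bisection_fan P D ->
  general_position P a -> maximal_cone D C -> relint C a ->
  C = closure [set b | general_position P b /\ bis_equiv P 0 a 0 b].
Proof.
move=> [fD Dab] ga mC rC; have [DC _] := mC; have [_ pD _ _] := fD.
apply/seteqP; split=> y.
  rewrite -{1}(closure_relint (pD _ DC) rC) => /closureP cy; apply/closureP => e e0.
  have e2 : 0 < e / 2 by lra.
  have [w rw yw] := cy _ e2; have [f f0 sf] := relint_open rw.
  have m0 : 0 < Num.min f (e / 2) by rewrite lt_min f0.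
  have Hw : H w by case: rw.
  have [b gb wb] := gp_dense Hw m0; have Hb : H b by case: gb.
  exists b; last first.
    by rewrite [e]splitr; apply: box_trans yw _; apply: box_le wb; rewrite ge_min lexx orbT.
  split=> //; apply/Dab => //; exists C; split=> //.
  by apply: sf => //; apply: box_le wb; rewrite ge_min lexx.
move=> cy; apply: (polyhedral_closed (pD _ DC)).
apply: closureS cy => b [gb /(Dab a b ga gb)[C' [mC' ra rb]]].
have [DC' _] := mC'; suff <- : C' = C by apply: relint_sub.
by apply: mC.2 => //; apply: (fan_meet_eq fD DC DC' rC); apply: relint_sub ra.
Qed.

(** The cone [C] is a face of a maximal cone of [D1] having a point in general position in its
    interior; by [maximal_cone_closure] that maximal cone also belongs to [D2], and fans contain the
    faces of their cones. *)
Lemma bisection_fan_sub D1 D2 :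
  is_bisection_fan P D1 -> is_bisection_fan P D2 -> D1 `<=` D2.
Proof.
move=> b1 b2 C D1C; have [[fin1 p1 f1 i1] E1] := b1; have [[_ p2 f2 _] E2] := b2.
(* Reflexivity of the equivalence places each point in general position inside a maximal cone. *)
have ex D a : is_bisection_fan P D -> general_position P a ->
    exists C, maximal_cone D C /\ relint C a.
  by move=> [_ Dab] ga; have [] := (Dab a a ga ga).1 (fun F G _ _ => iff_refl _);
    move=> C' [? ? _]; exists C'.
have [z az] := polyhedral_absorbs (p1 _ D1C).
(* By density the union of these finitely many closed cones contains [z], the chosen point in the
   interior of [C] relative to its span. *)
pose D1' := [set C' | D1 C' /\
  exists a, [/\ general_position P a, maximal_cone D1 C' & relint C' a]].
have : closure (\bigcup_(C' in D1') C') z.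
  apply/closureP => e e0; have Hz := polyhedral_subH (p1 _ D1C) az.1.
  have [a ga za] := gp_dense Hz e0; exists a => //.
  have [C' [mC' rC']] := ex D1 a b1 ga; exists C'; last exact: relint_sub.
  by split; [case: mC'|exists a].
have cl : closed (\bigcup_(C' in D1') C').
  apply: closed_bigcup; first by apply: sub_finite_set fin1 => C' [].
  by move=> C' [/p1 pC' _]; apply: polyhedral_closed.
move=> /cl[C' [D1C' [a [ga mC' rC']]] C'z].
have [C2 [mC2 rC2]] := ex D2 a b2 ga.
have C'2 : C' = C2.
  by rewrite (maximal_cone_closure b1 ga mC' rC') (maximal_cone_closure b2 ga mC2 rC2).
have [fC fC'] := i1 _ _ D1C D1C'.
have CC' : C `&` C' = C.
  by apply: (absorbs_face (p1 _ D1C) az fC); split=> //; have [] := az.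
by apply: (f2 C2); [case: mC2|rewrite -C'2 -CC'].
Qed.

Lemma bisection_fan_unique D1 D2 :
  is_bisection_fan P D1 -> is_bisection_fan P D2 -> D1 = D2.
Proof. by move=> b1 b2; apply/seteqP; split; apply: bisection_fan_sub. Qed.

End Uniqueness.
End Fans.

(** * The function p *)

Section Potential.
Variables (R : realType) (d : nat).
Local Notation V := 'rV[R]_d.
Local Notation H := (@H R d).
Local Notation L := (linearity_locus (@p R d)).
Implicit Types (x y z u v a : V) (I J K : {set 'I_d}).

Definition sign (b : bool) : R := if b then 1 else -1.

Definition signvec K : V := \row_i sign (i \in K).

Definition pos x : V := \row_i Num.max (x 0 i) 0.

(* [balance K x] is x^+(K) - x^+(~K). *)
Definition balance K x : R := dot (signvec K) (pos x).

(** On H this is the gauge of the root polytope, see [polytopeP] and [distE]. *)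
Definition mass x : R := \sum_i pos x 0 i.

Lemma pos_ge0 x i : 0 <= pos x 0 i.
Proof. by rewrite mxE le_max lexx orbT. Qed.

Lemma pos_ge x i : x 0 i <= pos x 0 i.
Proof. by rewrite mxE le_max lexx. Qed.

Lemma pos_id x i : 0 <= x 0 i -> pos x 0 i = x 0 i.
Proof. by move=> xi; rewrite mxE; apply: max_l. Qed.

Lemma pos_eq0 x i : x 0 i <= 0 -> pos x 0 i = 0.
Proof. by move=> xi; rewrite mxE; apply: max_r. Qed.

Lemma posB x i : pos x 0 i - pos (- x) 0 i = x 0 i.
Proof.
have [xi|/ltW xi] := leP 0 (x 0 i).
  by rewrite (pos_id xi) pos_eq0 ?subr0// mxE oppr_le0.
by rewrite (pos_eq0 xi) pos_id mxE ?oppr_ge0// sub0r opprK.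
Qed.

Lemma posZ c x : 0 <= c -> pos (c *: x) = c *: pos x.
Proof.
move=> c0; apply/rowP => i; rewrite !mxE.
have [xi|/ltW xi] := leP 0 (x 0 i); first by rewrite max_l// mulr_ge0.
by rewrite max_r ?mulr0// mulr_ge0_le0.
Qed.

Lemma massZ c x : 0 <= c -> mass (c *: x) = c * mass x.
Proof.
by move=> c0; rewrite /mass mulr_sumr posZ//; apply: eq_bigr => i _; rewrite mxE.
Qed.

Lemma massD x y : mass (x + y) <= mass x + mass y.
Proof.
rewrite /mass -big_split; apply: ler_sum => i _ /=.
rewrite [leLHS]mxE ge_max addr_ge0 ?pos_ge0// andbT.
by rewrite mxE lerD ?pos_ge.
Qed.

Lemma massN x : H x -> mass (- x) = mass x.
Proof.
move=> /H_dot Hx; apply/eqP; rewrite eq_sym -subr_eq0 /mass -sumrB; apply/eqP; rewrite -[RHS]Hx.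
by apply: eq_bigr => i _; rewrite posB mxE mul1r.
Qed.

Lemma lipschitz_balance K : lipschitz (balance K).
Proof.
have [M M0 hM] := lipschitz_dot (signvec K); exists M => // x y e xy.
apply: hM => i; rewrite !mxE; apply: le_lt_trans (xy i).
have := ler_norm (y 0 i - x 0 i); have := ler_norm (x 0 i - y 0 i).
rewrite (distrC (x 0 i)).
have [yi|yi] := leP (y 0 i) 0; have [xi|xi] := leP (x 0 i) 0;
  rewrite ?subrr ?normr0 ?sub0r ?subr0 ?normrN ?normr_ge0 ?(gtr0_norm yi) ?(gtr0_norm xi)//; lra.
Qed.

Lemma lipschitz_balanceN K : lipschitz (fun x => balance K (- x)).
Proof.
have [M M0 hM] := lipschitz_balance K; exists M => // x y e xy.
by apply: hM => i; rewrite !mxE opprK addrC distrC.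
Qed.

(** By [slope_le] and [slope_code_of] this is a maximum of linear functions, hence convex, although
    its summands are not. *)
Definition total x : R := \sum_K `|balance K x|.

(** The maximum of [a(K)] over subsets of [I] is attained at the positive coordinates in [I]. So
    [f_ I a] is the larger of the positive masses of [I] and of its complement, and
    [max u v = (u + v + |u - v|) / 2]. *)
Lemma f_E I a : f_ I a = (mass a + `|balance I a|) / 2.
Proof.
pose s K := \sum_(i in K) pos a 0 i.
have leS K K' : K \subset K' -> s K <= s K'.
  move=> KK'; rewrite /s [leRHS](bigID (mem K))/=.
  rewrite [X in _ <= X + _](eq_bigl (mem K)) ?lerDl ?sumr_ge0// => [i _|i].
    exact: pos_ge0.
  by rewrite /= andbC; case: (boolP (i \in K)) => //= /(fintype.subsetP KK').
have leC K : coordsum a K <= s K by apply: ler_sum => i _; apply: pos_ge.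
have eqC K : coordsum a (K :&: [set i | 0 < a 0 i])%SET = s K.
  rewrite /coordsum /s [RHS](bigID (fun i => 0 < a 0 i))/= [X in _ = _ + X]big1.
    rewrite addr0; apply: eq_big => i; first by rewrite !inE.
    by rewrite !inE => /andP[_ /ltW/pos_id].
  by move=> i /andP[_]; rewrite -leNgt => /pos_eq0.
have massE : mass a = s I + s (~: I)%SET.
  rewrite /mass /s (bigID (mem I))/=; congr (_ + _).
  by apply: eq_bigl => i; rewrite inE.
have balE : balance I a = s I - s (~: I)%SET.
  rewrite /balance /dot (bigID (mem I))/= /s -sumrN; congr (_ + _).
    by apply: eq_bigr => i iI; rewrite [signvec I 0 i]mxE /sign iI mul1r.
  apply: eq_big => i; first by rewrite inE.
  by move=> /negbTE iI; rewrite [signvec I 0 i]mxE /sign iI mulN1r.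
rewrite massE balE -maxr_absE; apply/eqP; rewrite eq_le; apply/andP; split.
  apply: bigmax_le; first by rewrite le_max sumr_ge0// => i _; apply: pos_ge0.
  by move=> K /orP[] /leS KI; rewrite le_max !(le_trans (leC K) KI)// orbT.
rewrite ge_max; apply/andP; split.
  by apply: (bigmax_sup (I :&: [set i | 0 < a 0 i])%SET); rewrite ?eqC// subsetIl.
by apply: (bigmax_sup (~: I :&: [set i | 0 < a 0 i])%SET); rewrite ?eqC// subsetIl orbT.
Qed.

Lemma g_E I a : g_ I a = - f_ I (- a).
Proof.
rewrite /g_ /f_ (big_morph -%R (@oppr_max R) (oppr0 _)); apply: eq_bigr => K _.
by rewrite /coordsum -sumrN; apply: eq_bigr => i _; rewrite mxE opprK.
Qed.

(** The mass terms of [f_] and [g_] cancel, because [mass] is even on H. *)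
Lemma pE a : H a -> p a = (total a - total (- a)) / 2.
Proof.
move=> Ha; rewrite /p /total -sumrB mulr_suml; apply: eq_bigr => I _.
by rewrite g_E !f_E massN//; lra.
Qed.

Lemma pN a : p (- a) = - p a.
Proof.
rewrite /p -sumrN; apply: eq_bigr => I _.
by rewrite !g_E opprK opprD opprK addrC.
Qed.

Definition code := {ffun {set 'I_d} -> bool}.

Definition weights (w : code) : V := \sum_K sign (w K) *: signvec K.

Lemma dot_weights w y : dot (weights w) y = \sum_K sign (w K) * dot (signvec K) y.
Proof. by rewrite dot_suml; apply: eq_bigr => K _; rewrite dotZl. Qed.

(** Sets [K] containing [i] are paired with [K :\ i]: the two sign vectors differ only in coordinate
    [i]. *)
Lemma weightsE w i :
  weights w 0 i = \sum_(K : {set 'I_d} | i \in K) (sign (w K) - sign (w (K :\ i)%SET)).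
Proof.
rewrite /weights summxE (bigID (fun K : {set 'I_d} => i \in K))/= sumrB; congr (_ + _).
  by apply: eq_bigr => K iK; rewrite !mxE iK mulr1.
rewrite -sumrN (reindex_onto (fun K => K :\ i)%SET (fun K => i |: K)%SET)/=; last first.
  by move=> K iK; rewrite setU1K.
apply: eq_big => K.
  rewrite !inE eqxx /=; apply/eqP/idP => [<-|iK]; first by rewrite !inE eqxx.
  by rewrite finset.setD1K.
by move=> _; rewrite !mxE !inE eqxx/= /sign; case: ifP; lra.
Qed.

(* Only these codes give linear functions bounded above by [total]; the others
   are replaced by 0, which is harmless since [total] is nonnegative. *)
Definition good w := [forall i, 0 <= weights w 0 i].

Definition slope w : V := if good w then weights w else 0.

Lemma sign_le b (t : R) : sign b * t <= `|t|.
Proof.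
by rewrite /sign; case: b; rewrite ?mul1r ?mulN1r ?ler_norm// -normrN ler_norm.
Qed.

Lemma sum_sign_eq (T : finType) (w : T -> bool) (b : T -> R) :
  \sum_t `|b t| <= \sum_t sign (w t) * b t ->
  forall t, sign (w t) * b t = `|b t|.
Proof.
move=> le_b t; have ge0 s : true -> 0 <= `|b s| - sign (w s) * b s.
  by move=> _; rewrite subr_ge0 sign_le.
have e0 : \sum_s (`|b s| - sign (w s) * b s) = 0.
  by apply/eqP; rewrite eq_le sumr_ge0// andbT sumrB subr_le0.
by have /eqP := psumr_eq0P ge0 e0 (i := t) isT; rewrite subr_eq0 => /eqP.
Qed.

Lemma dot_le_pos w y : good w -> dot (weights w) y <= dot (weights w) (pos y).
Proof.
by move=> /forallP gw; apply: ler_sum => i _; rewrite ler_wpM2l ?pos_ge.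
Qed.

Lemma total_ge0 y : 0 <= total y.
Proof. exact: sumr_ge0. Qed.

Lemma slope_le w y : dot (slope w) y <= total y.
Proof.
rewrite /slope; case: ifP => [gw|_]; last by rewrite dot0l total_ge0.
rewrite (le_trans (dot_le_pos y gw))// dot_weights ler_sum// => K _.
exact: sign_le.
Qed.

(** Equality in [slope_le] forces equality in each summand. If [w] is not good, then [total y] is 0
    and all balances vanish. *)
Lemma slope_eq w y K : dot (slope w) y = total y ->
  sign (w K) * balance K y = `|balance K y|.
Proof.
rewrite /slope; case: ifP => [gw|_]; last first.
  rewrite dot0l => /esym/(psumr_eq0P (fun _ _ => normr_ge0 _))/(_ K isT) e.
  by rewrite e; move/normr0_eq0: e => ->; rewrite mulr0.
move=> e; apply: (sum_sign_eq (b := fun K => balance K y)).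
by have := dot_le_pos y gw; rewrite e dot_weights.
Qed.

Definition code_of x : code := [ffun K => 0 <= balance K x].

Lemma balanceD1 K i x : i \in K -> balance K x = balance (K :\ i)%SET x + 2 * pos x 0 i.
Proof.
move=> iK; rewrite /balance /dot (bigD1 i)//= [in RHS](bigD1 i)//=.
rewrite [signvec K 0 i]mxE [signvec (K :\ i)%SET 0 i]mxE !inE iK eqxx/=.
rewrite [X in _ = _ + X + _](eq_bigr (fun j => signvec K 0 j * pos x 0 j)).
  by rewrite /sign; ring.
by move=> j ji; rewrite !(mxE, inE) ji.
Qed.

(** Adding [i] to a set raises its balance by twice the positive part of coordinate [i]; so the code
    is monotone, and insensitive to [i] when that positive part is 0. *)
Lemma code_of_weights x i : 0 <= weights (code_of x) 0 i /\
  (x 0 i <= 0 -> weights (code_of x) 0 i = 0).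
Proof.
rewrite weightsE; split=> [|xi].
  apply: sumr_ge0 => K iK; rewrite !ffunE (balanceD1 x iK) /sign.
  by have := pos_ge0 x i; do 2!case: ifP; lra.
by apply: big1 => K iK; rewrite !ffunE (balanceD1 x iK) (pos_eq0 xi) mulr0 addr0 subrr.
Qed.

(** The coefficients vanish where [x] is nonpositive, so [x] may be replaced by [pos x], and the
    signs then turn each balance into its absolute value. *)
Lemma slope_code_of x : dot (slope (code_of x)) x = total x.
Proof.
rewrite /slope; case: ifPn => [_|/forallPn[i]]; last by rewrite (code_of_weights x i).1.
rewrite (_ : dot _ x = dot (weights (code_of x)) (pos x)); last first.
  apply: eq_bigr => i _; have [xi|xi] := leP 0 (x 0 i); first by rewrite pos_id.
  by rewrite (code_of_weights x i).2 ?mul0r// ltW.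
rewrite dot_weights; apply: eq_bigr => K _; rewrite ffunE /sign.
case: ifPn => h; first by rewrite mul1r ger0_norm.
by rewrite mulN1r ltr0_norm// ltNge.
Qed.

(** The linear pieces of [total y + total (- y)]; the second piece is evaluated at [- y], hence the
    minus sign. *)
Definition slopes (w : code * code) : V := slope w.1 - slope w.2.

Definition codes_of x := (code_of x, code_of (- x)).

Lemma max_region_slopesP w y : max_region slopes w y <->
  [/\ H y, dot (slope w.1) y = total y & dot (slope w.2) (- y) = total (- y)].
Proof.
have le w' := slope_le w' y; have leN w' := slope_le w' (- y).
split=> [[Hy qy]|[Hy e1 e2]].
  have := qy (codes_of y); rewrite /slopes !dotBl -!dotNr !slope_code_of => h.
  by have := le w.1; have := leN w.2; split=> //; lra.
split=> // k; rewrite /slopes !dotBl -!dotNr e1 e2.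
by have := le k.1; have := leN k.2; lra.
Qed.

Lemma max_region_linear w : relint (max_region slopes w) `<=` L.
Proof.
move=> x /relintP[Hx [e e0 sM]]; split=> //.
(* Here [total (- y)] is [- dot (slope w.2) y], so the difference in [pE] becomes a sum of
   slopes. *)
exists (dot (2^-1 *: (slope w.1 + slope w.2)) : {scalar V}); apply/nearHP.
exists e => // y Hy /(sM y Hy)/max_region_slopesP[_ e1 e2].
by rewrite pE// -e1 -e2 /= dotZl dotDl dotNr; lra.
Qed.

Definition balanced x K := balance K x = 0 \/ balance K (- x) = 0.

Lemma relint_forall (T : finType) (A : T -> set V) x : H x ->
  (forall t, relint (A t) x) -> relint [set y | forall t, A t y] x.
Proof.
move=> Hx rA; split=> //; exact: (@filter_forall _ _ A _ _ (fun t => (rA t).2)).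
Qed.

Lemma same_codes x y : (forall K, 0 < balance K x * balance K y) -> code_of x = code_of y.
Proof.
move=> xy; apply/ffunP => K; rewrite !ffunE; apply/idP/idP => h.
  by have := xy K; rewrite leNgt; apply: contraL => ?; rewrite -leNgt mulr_ge0_le0// ltW.
by have := xy K; rewrite leNgt; apply: contraL => ?; rewrite -leNgt mulr_le0_ge0// ltW.
Qed.

Lemma relint_same_sign (h : V -> R) x : lipschitz h -> H x -> h x <> 0 ->
  relint [set y | 0 < h x * h y] x.
Proof.
move=> lh Hx /eqP hx; have := lipschitz_gt0 (lipschitzZ (h x) lh) (x := x).
rewrite -expr2 exprn_even_gt0//= => /(_ hx)[e e0 he].
by apply/relintP; split=> //; exists e => // y _ /he.
Qed.

Lemma unbalanced_relint x : H x -> (forall K, ~ balanced x K) ->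
  relint (max_region slopes (codes_of x)) x.
Proof.
move=> Hx bx.
have r1 K : relint [set y | 0 < balance K x * balance K y] x.
  by apply: relint_same_sign => //; [apply: lipschitz_balance|move=> b0; apply: (bx K); left].
have r2 K : relint [set y | 0 < balance K (- x) * balance K (- y)] x.
  apply: (@relint_same_sign (fun y => balance K (- y))) => //; first exact: lipschitz_balanceN.
  by move=> b0; apply: (bx K); right.
have := (relintI _ _ x).2 (conj (relint_forall Hx r1) (relint_forall Hx r2)).
move=> /relintP[_ [e e0 se]]; apply/relintP; split=> //; exists e => // y Hy xy.
have [s1 s2] := se y Hy xy; apply/max_region_slopesP.
by rewrite /codes_of (same_codes s1) (same_codes s2) /= !slope_code_of.
Qed.

Lemma linear_second_difference x v : L x -> H v ->
  exists2 t, 0 < t & forall s, 0 <= s <= t -> p (x + s *: v) + p (x - s *: v) = 2 * p x.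
Proof.
move=> [Hx [l /nearHP[e e0 pl]]] Hv; have [t t0 ht] := small_step v e0.
exists t => // s /andP[s0 st]; rewrite !pl//.
- by rewrite linearB linearD; lra.
- exact: box_refl.
- exact/HB/HZ.
- by rewrite -scaleNr; apply: ht; rewrite normrN ger0_norm.
- exact/HD/HZ.
- by apply: ht; rewrite ger0_norm.
Qed.

Lemma mass_gt0 x : H x -> x != 0 -> 0 < mass x.
Proof.
move=> Hx x0; rewrite lt_neqAle sumr_ge0 ?andbT; last by move=> i _; apply: pos_ge0.
apply: contra_neq x0 => /esym m0; apply/rowP => i; rewrite mxE -posB.
have e (y : V) : mass y = 0 -> pos y 0 i = 0.
  by move=> /(psumr_eq0P (fun i _ => pos_ge0 y i)); apply.
by rewrite !e ?massN// subrr.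
Qed.

Lemma mass0 x : H x -> mass x = 0 -> x = 0.
Proof.
by move=> Hx m0; apply: contrapT => /eqP /(mass_gt0 Hx); rewrite m0 ltxx.
Qed.

(* Moving mass between two positive coordinates on opposite sides of K bends
   the K-th term of [total x] and leaves [total (- x)] alone. *)
Lemma linear_balance_neq0 x K : L x -> x != 0 -> balance K x <> 0.
Proof.
move=> Lx x0 b0; have Hx : H x by case: Lx.
(* A set of balance 0 must contain a positive coordinate, for otherwise its balance would be
   [- mass x]. This applies to [K] and to its complement. *)
have [m0 neg] : 0 < mass x /\ forall K, balance K x = 0 -> exists2 i, i \in K & 0 < x 0 i.
  split=> [|K' b0']; first exact: mass_gt0.
  apply: contrapT => nex; suff : balance K' x = - mass x.
    by rewrite b0'; have := mass_gt0 Hx x0; lra.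
  rewrite /balance /mass /dot -sumrN; apply: eq_bigr => i _; rewrite [signvec _ _ _]mxE.
  rewrite /sign; case: ifP => iK; last by rewrite mulN1r.
  rewrite pos_eq0 ?mulr0 ?oppr0// leNgt; apply/negP => xi.
  by apply: nex; exists i.
have balC : balance (~: K)%SET x = - balance K x.
  rewrite /balance -dotNl; congr dot; apply/rowP => i; rewrite !mxE inE /sign.
  by case: (i \in K) => /=; rewrite ?opprK.
have [i iK xi] := neg K b0.
have [j] : exists2 j, j \in (~: K)%SET & 0 < x 0 j by apply: neg; rewrite balC b0 oppr0.
rewrite inE => jK xj; pose v : V := delta_mx 0 i - delta_mx 0 j.
have ij : i != j by apply: contraNneq jK => <-.
have ve k : v 0 k = (k == i)%:R - (k == j)%:R by rewrite !mxE eqxx.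
have dotv w : dot w v = w 0 i - w 0 j by rewrite dotBr !dot_delta.
have Hv : H v by apply/H_dot; rewrite dotv !mxE subrr.
have vk k : k != i -> k != j -> v 0 k = 0.
  by rewrite ve => /negbTE -> /negbTE ->; rewrite subrr.
have vi : v 0 i = 1 by rewrite ve eqxx (negbTE ij) subr0.
have vj : v 0 j = -1 by rewrite ve eqxx eq_sym (negbTE ij) sub0r.
have [t t0 ht] := linear_second_difference Lx Hv.
(* With this bound the coordinates [i] and [j] stay nonnegative under both shifts, so [pos] moves
   linearly and [pos] of the opposite point is unchanged. *)
pose s := Num.min t (Num.min (x 0 i) (x 0 j)).
have s0 : 0 < s by rewrite !lt_min t0 xi xj.
have [st sxi sxj] : [/\ s <= t, s <= x 0 i & s <= x 0 j].
  by split; rewrite /s !ge_min lexx ?orbT.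
clearbody v s.
have posE r : `|r| <= s -> pos (x + r *: v) = pos x + r *: v /\
    pos (- (x + r *: v)) = pos (- x).
  rewrite ler_norml => /andP[r1 r2].
  have zE k : (x + r *: v) 0 k = x 0 k + r * v 0 k by rewrite !mxE.
  have oppE (y : V) k : (- y) 0 k = - y 0 k by rewrite mxE.
  have z_ge0 k : k = i \/ k = j -> 0 <= x 0 k /\ 0 <= (x + r *: v) 0 k.
    by case=> ->; rewrite zE ?vi ?vj; split; lra.
  split; apply/rowP => k.
    rewrite [RHS]mxE [(r *: v) 0 k]mxE.
    have [ij_k|nij_k] := pselect (k = i \/ k = j).
      by have [h1 h2] := z_ge0 k ij_k; rewrite !pos_id.
    rewrite [LHS]mxE zE [in RHS]mxE vk ?mulr0 ?addr0//; apply/eqP => e; apply: nij_k; tauto.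
  have [ij_k|nij_k] := pselect (k = i \/ k = j).
    by have [h1 h2] := z_ge0 k ij_k; rewrite !pos_eq0// oppE oppr_le0.
  rewrite [LHS]mxE [in RHS]mxE !oppE zE vk ?mulr0 ?addr0//; apply/eqP => e; apply: nij_k; tauto.
have [ps psN] := posE s ltac:(by rewrite gtr0_norm).
have [ms msN] := posE (- s) ltac:(by rewrite normrN gtr0_norm).
have := ht s ltac:(by rewrite (ltW s0)).
rewrite !pE//; [|exact/HB/HZ|exact/HD/HZ].
rewrite -scaleNr /total /balance psN msN ps ms => e.
(* The second difference of the term of [K'] is nonnegative by the triangle inequality. The sum is
   0, whereas the term of [K] equals [4 * s]. *)
pose bend K' := `|balance K' x + s * dot (signvec K') v| +
  `|balance K' x - s * dot (signvec K') v| - 2 * `|balance K' x|.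
have bend0 : \sum_K' bend K' = 0.
  rewrite /bend sumrB big_split/= -mulr_sumr /balance.
  under eq_bigr do rewrite -dotZr -dotDr.
  under [X in _ + X - _]eq_bigr do rewrite -mulNr -dotZr -dotDr.
  lra.
have bend_ge0 K' : true -> 0 <= bend K'.
  move=> _; rewrite /bend; set b := balance _ _; set c := s * _.
  have := ler_normD (b + c) (b - c); rewrite (_ : b + c + (b - c) = 2 * b); last by ring.
  by rewrite normrM normr_nat; lra.
have := psumr_eq0P bend_ge0 bend0 (i := K) isT; rewrite /bend b0 normr0 mulr0 subr0.
rewrite add0r sub0r normrN dotv !mxE iK (negbTE jK) /sign => h.
by have := ler_norm (s * (1 - -1)); lra.
Qed.

Lemma linear_locusN x : L x -> L (- x).
Proof.
move=> [Hx [l /nearHP[e e0 pl]]]; split; first exact: HN.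
exists l; apply/nearHP; exists e => // y Hy xy.
rewrite -[y]opprK pN pl ?linearN//; first exact: HN.
by move=> i; have := xy i; rewrite !mxE opprK -opprD normrN.
Qed.

Lemma linear_locus_open x : L x ->
  exists2 e, 0 < e & forall y, H y -> box x e y -> L y.
Proof.
move=> [Hx [l nl]].
have [e e0 he] := relint_open (conj Hx nl : relint [set y | p y = l y] x).
by exists e => // y Hy /(he y Hy)[_ pl]; split=> //; exists l.
Qed.

End Potential.

(** * Regions of the two fans *)

Section Resonance.
Variables (R : realType) (d : nat).
Local Notation V := 'rV[R]_d.
Local Notation H := (@H R d).
Local Notation U := (@resonance_complement R d).
Implicit Types (x y z u v a : V) (I J K : {set 'I_d}).

Definition indicator I : V := \row_i (i \in I)%:R.

Lemma coordsumE x I : coordsum x I = dot (indicator I) x.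
Proof.
rewrite /coordsum /dot big_mkcond; apply: eq_bigr => i _; rewrite mxE.
by case: (i \in I); rewrite ?mul1r ?mul0r.
Qed.

(** The linear pieces of the convex function [sum_I |x(I)|], whose regions of linearity are the
    chambers of the arrangement. *)
Definition resonance_slope (s : code d) : V := \sum_I sign R (s I) *: indicator I.

Definition resonance_code x : code d := [ffun I => 0 <= coordsum x I].

Lemma dot_resonance_slope s y :
  dot (resonance_slope s) y = \sum_I sign R (s I) * coordsum y I.
Proof. by rewrite dot_suml; apply: eq_bigr => I _; rewrite dotZl coordsumE. Qed.

Lemma max_region_resonanceP s y : max_region resonance_slope s y <->
  H y /\ forall I, sign R (s I) * coordsum y I = `|coordsum y I|.
Proof.
split=> [[Hy qy]|[Hy sy]].
  split=> //; apply: (sum_sign_eq (b := coordsum y)).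
  have := qy (resonance_code y); rewrite !dot_resonance_slope; apply: le_trans.
  apply: ler_sum => I _; rewrite ffunE /sign; case: ifPn => h.
    by rewrite mul1r ger0_norm.
  by rewrite mulN1r ltr0_norm// ltNge.
split=> // k; rewrite !dot_resonance_slope ler_sum// => I _.
by rewrite sy sign_le.
Qed.

Lemma resonance_relint x : U x ->
  relint (max_region resonance_slope (resonance_code x)) x.
Proof.
move=> [Hx Ux].
have r I : relint [set y | I <> finset.set0 -> I <> [set: 'I_d]%SET ->
    0 < coordsum x I * coordsum y I] x.
  have [[I0 IT]|I0T] := pselect (I <> finset.set0 /\ I <> [set: 'I_d]%SET); last first.
    by apply/relintP; split=> //; exists 1 => // y _ _ I0 IT; case: I0T.
  have := Ux I I0 IT; rewrite coordsumE => /(relint_same_sign (lipschitz_dot _) Hx).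
  move=> /relintP[_ [e e0 se]]; apply/relintP; split=> //; exists e => //.
  by move=> y Hy xy _ _; rewrite !coordsumE; apply: se.
have /relintP[_ [e e0 se]] := relint_forall Hx r.
apply/relintP; split=> //; exists e => // y Hy xy; apply/max_region_resonanceP.
split=> // I; have [->|/eqP I0] := eqVneq I finset.set0.
  by rewrite /coordsum big_set0 mulr0 normr0.
have [->|/eqP IT] := eqVneq I [set: 'I_d]%SET.
  by rewrite [coordsum y _]Hy mulr0 normr0.
have := se y Hy xy I I0 IT; rewrite ffunE /sign; case: ifPn => h h'.
  rewrite mul1r ger0_norm// leNgt; apply/negP => y0.
  by move: h'; rewrite ltNge mulr_ge0_le0// ltW.
rewrite mulN1r ler0_norm// leNgt; apply/negP => y0.
by move: h'; rewrite ltNge mulr_le0_ge0 ?(ltW y0)// ltW// ltNge.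
Qed.

Lemma root_H i j : H (delta_mx 0 i - delta_mx 0 j).
Proof. by apply/H_dot; rewrite dotBr !dot_delta !mxE subrr. Qed.

Lemma proper_separated I : I <> finset.set0 -> I <> [set: 'I_d]%SET ->
  exists i j, i \in I /\ j \notin I.
Proof.
move=> /eqP/set0Pn[i iI] /eqP; rewrite -finset.subTset => /fintype.subsetPn[j _ jI].
by exists i, j.
Qed.

Lemma max_region_resonance_sub s :
  relint (max_region resonance_slope s) `<=` U.
Proof.
move=> x rx; have Hx : H x by case: rx.
split=> // I I0 IT x0; have [i [j [iI jI]]] := proper_separated I0 IT.
(* If [x(I)] were 0, subtracting this multiple of a root would make [x(I)] have the sign opposite to
   [s I]. *)
have [e e0] := relint_subtract rx (HZ (sign R (s I)) (root_H i j)).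
move=> /max_region_resonanceP[_ /(_ I)].
rewrite coordsumE dotBr -coordsumE x0 !dotZr dotBr !dot_delta !mxE iI (negbTE jI).
rewrite /= subr0 mulr1 sub0r => h; have := normr_ge0 (- (e * sign R (s I))).
by rewrite -h /sign; case: (s I); lra.
Qed.

Lemma resonance_component x : U x -> closure (connected_component U x) =
  max_region resonance_slope (resonance_code x).
Proof.
(* The trivial index sets get the constant 1, because [h] must not vanish on the complement of the
   arrangement. *)
move=> Ux; pose h (I : {set 'I_d}) (y : V) : R :=
  if (I == finset.set0) || (I == [set: 'I_d]%SET) then 1 else coordsum y I.
apply: (component_max_region (h := h)) => //.
- exact: resonance_relint.
- exact: max_region_resonance_sub.
- move=> I; have [b|b] := boolP ((I == finset.set0) || (I == [set: 'I_d]%SET)).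
    by exists 0 => // y z e _; rewrite /h b subrr normr0 mul0r.
  have [M M0 hM] := lipschitz_dot (indicator I); exists M => // y z e yz.
  by rewrite /h (negbTE b) !coordsumE hM.
- move=> I y [_ Uy]; rewrite /h; case: ifPn; first by rewrite oner_neq0.
  by rewrite negb_or => /andP[/eqP I0 /eqP IT]; apply/eqP/Uy.
move=> y Uy xy; suff -> : resonance_code x = resonance_code y by apply: resonance_relint.
have [Hx _] := Ux; have [Hy _] := Uy.
apply/ffunP => I; rewrite !ffunE; have := xy I; rewrite /h.
have [->|I0] := eqVneq I finset.set0; first by rewrite /coordsum !big_set0.
have [->|IT] := eqVneq I [set: 'I_d]%SET => /=; first by rewrite [coordsum x _]Hx [coordsum y _]Hy.
move=> h0; apply/idP/idP => h1; rewrite leNgt; apply/negP => h2;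
  by move: h0; rewrite ltNge ?(mulr_ge0_le0 h1 (ltW h2))// (mulr_le0_ge0 (ltW h2) h1).
Qed.

Lemma resonance_code_eq x y : U x -> U y ->
  max_region resonance_slope (resonance_code x) y ->
  resonance_code x = resonance_code y.
Proof.
move=> [Hx Ux] [Hy Uy] /max_region_resonanceP[_ sy].
apply/ffunP => I; rewrite !ffunE.
have [->|/eqP I0] := eqVneq I finset.set0; first by rewrite /coordsum !big_set0.
have [->|/eqP IT] := eqVneq I [set: 'I_d]%SET; first by rewrite [coordsum x _]Hx [coordsum y _]Hy.
have := sy I; rewrite ffunE /sign; have := Uy I I0 IT.
have := normr_ge0 (coordsum y I).
case: ifP => h0 h1 h2 h3; last first.
  by apply/esym/negbTE; rewrite -ltNge lt_neqAle; apply/andP; split; [apply/eqP|lra].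
by apply/esym; lra.
Qed.

Lemma resonance_neq0 x : (1 < d)%N -> U x -> x != 0.
Proof.
move=> d2 [_ Ux]; pose i : 'I_d := Ordinal (ltnW d2); pose j : 'I_d := Ordinal d2.
apply/eqP => x0; apply: (Ux [set i]%SET).
- by move=> /finset.setP/(_ i); rewrite !inE eqxx.
- by move=> /finset.setP/(_ j); rewrite !inE.
- by rewrite x0 /coordsum big1// => k _; rewrite mxE.
Qed.

End Resonance.

(** * Regions of linearity of [p] *)

Section Regions.
Variable R : realType.

(** The coordinates of [y] are opposite, so both [y] and [- y] have at most one positive coordinate,
    of the same size. Hence [p] vanishes on H when d = 2. *)
Lemma total2N (y : 'rV[R]_2) : H y -> total (- y) = total y.
Proof.
move=> Hy; apply: eq_bigr => K _; rewrite /balance /dot !big_ord_recl !big_ord0 !addr0.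
set i : 'I_2 := ord0; set j := lift ord0 ord0.
have y0 : y 0 i + y 0 j = 0.
  by have := (H_dot y).1 Hy; rewrite /dot !big_ord_recl big_ord0 addr0 !mxE !mul1r.
have yj : y 0 j = - y 0 i by lra.
have sgn (k l : 'I_2) (t : R) : `|signvec R K 0 k * t| = `|signvec R K 0 l * t|.
  by rewrite !mxE /sign; do 2!case: ifP => _; rewrite ?mul1r ?mulN1r ?normrN.
have oppE k : (- y) 0 k = - y 0 k by rewrite mxE.
have [yi|/ltW yi] := leP 0 (y 0 i).
  rewrite (pos_id yi) (@pos_eq0 _ _ y) ?yj ?oppr_le0// (@pos_eq0 _ _ (- y)) ?oppE ?oppr_le0//.
  by rewrite pos_id oppE yj opprK// !mulr0 addr0 add0r (sgn j i).
rewrite (pos_eq0 yi) (@pos_id _ _ y) ?yj ?oppr_ge0// (@pos_id _ _ (- y)) ?oppE ?oppr_ge0//.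
by rewrite pos_eq0 ?oppE ?yj ?opprK// !mulr0 addr0 add0r (sgn j i).
Qed.

Lemma linear_locus2 d (y : 'rV[R]_d) : d = 2 -> H y -> linearity_locus (@p R d) y.
Proof.
move=> d2; subst d => Hy; split=> //; exists (dot 0 : {scalar _}); apply/nearHP; exists 1 => // z Hz _.
by rewrite pE// total2N// subrr mul0r /= dot0l.
Qed.

(** Near 0 there are positive multiples of [e_i + e_j - 2 e_k]. They have balance 0 at [[set i]], so
    [linear_balance_neq0] keeps them out of the linearity locus, which is open. *)
Lemma linear_locus_neq0 d (x : 'rV[R]_d) : (2 < d)%N -> linearity_locus (@p R d) x -> x != 0.
Proof.
move=> d3 Lx; apply/eqP => x0; have [e e0 Le] := linear_locus_open Lx.
pose i : 'I_d := Ordinal (ltnW (ltnW d3)); pose j : 'I_d := Ordinal (ltnW d3).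
pose k : 'I_d := Ordinal d3.
pose v : 'rV[R]_d := delta_mx 0 i - delta_mx 0 k + (delta_mx 0 j - delta_mx 0 k).
have [t t0 /(_ t 0)] := small_step v e0; rewrite gtr0_norm// => /(_ (lexx _)).
rewrite add0r -x0 => /(Le _ (HZ _ (HD (root_H R i k) (root_H R j k)))) Lv.
have vi : (t *: v) 0 i = t by rewrite !mxE /=; lra.
have vj : (t *: v) 0 j = t by rewrite !mxE /=; lra.
apply: (@linear_balance_neq0 _ _ _ [set i]%SET Lv).
  by apply/eqP => /rowP/(_ i); rewrite vi mxE; apply/eqP; rewrite gt_eqF.
rewrite /balance /dot (bigD1 i)//= (bigD1 j)//= big1 => [|l /andP[li lj]].
  rewrite !pos_id ?vi ?vj ?(ltW t0)// ![signvec _ _ _ _]mxE !inE eqxx /sign /=.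
  by lra.
rewrite pos_eq0 ?mulr0// !mxE (negbTE li) (negbTE lj) /=.
by case: (l == k) => /=; nra.
Qed.

Variables (d : nat) (d2 : (1 < d)%N).
Local Notation V := 'rV[R]_d.
Local Notation H := (@H R d).
Local Notation L := (linearity_locus (@p R d)).
Local Notation U := (@resonance_complement R d).
Implicit Types (x y : V).

(* The case d = 2 is special: there p vanishes on H, so its single region of
   linearity is H, while [total] still has a kink at 0. *)
Definition region_slopes (w : code d * code d) : V := if d == 2 then 0 else slopes R w.

Lemma max_region_cst (w : code d * code d) : max_region (fun=> 0) w = H.
Proof. by apply/seteqP; split=> x => [[]|Hx]//; split=> // k; rewrite !dot0l. Qed.

Lemma relint_H x : H x -> relint H x.
Proof. by move=> Hx; apply/relintP; split=> //; exists 1. Qed.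

Lemma linear_unbalanced x K : L x -> x != 0 -> ~ balanced x K.
Proof.
move=> Lx x0 []; first exact: linear_balance_neq0.
by apply: linear_balance_neq0; [apply: linear_locusN|rewrite oppr_eq0].
Qed.

Lemma region_relint x : L x -> relint (max_region region_slopes (codes_of x)) x.
Proof.
move=> Lx; have [Hx _] := Lx; have [d_eq2|d_ne2] := eqVneq d 2.
  rewrite (_ : region_slopes = fun=> 0) ?max_region_cst; first exact: relint_H.
  by apply/funext => w; rewrite /region_slopes ifT//; apply/eqP.
have d3 : (2 < d)%N by rewrite ltn_neqAle eq_sym d_ne2.
rewrite (_ : region_slopes = @slopes R d); last first.
  by apply/funext => w; rewrite /region_slopes (negbTE d_ne2).
by apply: unbalanced_relint => // K; apply: linear_unbalanced => //; apply: linear_locus_neq0.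
Qed.

Lemma region_sub w : relint (max_region region_slopes w) `<=` L.
Proof.
have [d_eq2|d_ne2] := eqVneq d 2.
  by move=> x [Hx _]; apply: linear_locus2.
rewrite (_ : region_slopes = @slopes R d); first exact: max_region_linear.
by apply/funext => w'; rewrite /region_slopes (negbTE d_ne2).
Qed.

Lemma region_component x : L x -> closure (connected_component L x) =
  max_region region_slopes (codes_of x).
Proof.
move=> Lx; have rx := region_relint Lx; have [d_eq2|d_ne2] := eqVneq d 2.
  apply: (component_max_region (I := void) (h := fun _ _ => 1)) => //.
    exact: region_sub.
  move=> y Ly _; rewrite (_ : region_slopes = fun=> 0) ?max_region_cst.
    by apply: relint_H; case: Ly.
  by apply/funext => w; rewrite /region_slopes ifT//; apply/eqP.
have d3 : (2 < d)%N by rewrite ltn_neqAle eq_sym d_ne2.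
have nb y K : L y -> ~ balanced y K.
  by move=> Ly; apply: linear_unbalanced => //; apply: linear_locus_neq0.
pose h (i : {set 'I_d} + {set 'I_d}) y : R :=
  match i with inl K => balance K y | inr K => balance K (- y) end.
apply: (component_max_region (h := h)) => //.
- exact: region_sub.
- by case=> K; [apply: lipschitz_balance|apply: lipschitz_balanceN].
- by case=> K y Ly; apply/eqP => hy; apply: (nb y K Ly); [left|right].
move=> y Ly xy; rewrite /codes_of (same_codes (fun K => xy (inl K))).
by rewrite (same_codes (fun K => xy (inr K))); apply: region_relint.
Qed.

End Regions.

(** * Cells of the common refinement *)

Section Density.
Variables (R : realType) (d : nat).
Local Notation V := 'rV[R]_d.
Local Notation H := (@H R d).
Local Notation L := (linearity_locus (@p R d)).
Local Notation U := (@resonance_complement R d).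
Implicit Types (x y v : V) (I J K : {set 'I_d}).

(** The hyperplanes are left one at a time, by a step so small that those already avoided remain
    avoided. *)
Lemma avoid_hyperplanes (T : finType) (P : pred T) (l : T -> V) :
  (forall t, P t -> exists2 v, H v & dot (l t) v <> 0) ->
  forall x e, H x -> 0 < e ->
  exists2 y, H y /\ (forall t, P t -> dot (l t) y <> 0) & box x e y.
Proof.
move=> Pl x e Hx e0.
suff : forall s : seq T, exists2 y, H y /\ (forall t, t \in s -> P t -> dot (l t) y <> 0) & box x e y.
  move=> /(_ (enum T))[y [Hy ly] xy]; exists y => //; split=> // t.
  by apply: ly; rewrite mem_enum.
move=> s; elim: s e e0 => [|t s IH] e e0; first by exists x; [|apply: box_refl].
have e2 : 0 < e / 2 by lra.
have [y [Hy ly] xy] := IH _ e2.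
have near_y t' : relint [set z | t' \in s -> P t' -> dot (l t') z <> 0] y.
  have [/andP[ts Pt]|nts] := boolP ((t' \in s) && P t').
    have := relint_same_sign (lipschitz_dot (l t')) Hy (ly t' ts Pt).
    move=> /relintP[_ [f f0 sf]]; apply/relintP; split=> //; exists f => //.
    move=> z Hz yz _ _ z0; have := sf z Hz yz.
    by rewrite /= z0 mulr0 ltxx.
  apply/relintP; split=> //; exists 1 => // z _ _ ts Pt.
  by rewrite ts Pt in nts.
have /relintP[_ [f f0 sf]] := relint_forall Hy near_y.
have [y0|y_ne0] := eqVneq (dot (l t) y) 0; last first.
  exists y; last by apply: box_le xy; lra.
  by split=> // t'; rewrite inE => /orP[/eqP-> _|]; [apply/eqP|apply: ly].
have [/Pl[v Hv lv]|nPt] := boolP (P t); last first.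
  exists y; last by apply: box_le xy; lra.
  by split=> // t'; rewrite inE => /orP[/eqP->|]; [rewrite (negbTE nPt)|apply: ly].
have m0 : 0 < Num.min f (e / 2) by rewrite lt_min f0.
have [r r0 /(_ r y)] := small_step v m0; rewrite gtr0_norm// => /(_ (lexx _)) yv.
have Hyv : H (y + r *: v) by exact/HD/HZ.
exists (y + r *: v); last first.
  by rewrite [e]splitr; apply: box_trans xy _; apply: box_le yv; rewrite ge_min lexx orbT.
split=> // t'; rewrite inE => /orP[/eqP-> _|t's].
  by rewrite dotDr y0 add0r dotZr; apply/eqP; apply: mulf_neq0; [rewrite gt_eqF|apply/eqP].
by apply: sf => //; apply: box_le yv; rewrite ge_min lexx.
Qed.

(** Encodes the hyperplane [x(A) = x(B)] for disjoint [A] and [B]. Empty [B] gives the resonance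
    hyperplanes; splitting the positive support of [x] by [K] gives the zeros of [balance K]. *)
Definition separated_pair (A : {set 'I_d} * {set 'I_d}) :=
  [&& [disjoint A.1 & A.2], A.1 :|: A.2 != finset.set0 &
      A.1 :|: A.2 != [set: 'I_d]%SET].

Definition generic y := H y /\ forall A, separated_pair A ->
  dot (indicator R A.1 - indicator R A.2) y <> 0.

Lemma generic_dense x e : H x -> 0 < e -> exists2 y, generic y & box x e y.
Proof.
apply: avoid_hyperplanes => -[A B] /= /and3P[/= dAB /eqP AB0 /eqP ABT].
have [i [j [iAB]]] := proper_separated AB0 ABT; rewrite inE negb_or => /andP[jA jB].
exists (delta_mx 0 i - delta_mx 0 j); first exact: root_H.
rewrite dotBr !dot_delta !mxE (negbTE jA) (negbTE jB) !subr0.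
move: iAB; rewrite inE => /orP[iA|iB].
  by rewrite iA (disjointFr dAB iA) subr0; apply/eqP; rewrite oner_neq0.
by rewrite iB (disjointFl dAB iB) sub0r; apply/eqP; rewrite oppr_eq0 oner_neq0.
Qed.

Lemma genericN y : generic y -> generic (- y).
Proof.
move=> [Hy gy]; split=> [|A sA]; first exact: HN.
by rewrite dotNr => /eqP; rewrite oppr_eq0 => /eqP; apply: gy.
Qed.

Lemma generic_resonance y : generic y -> U y.
Proof.
move=> [Hy gy]; split=> // I I0 IT.
have := gy (I, finset.set0); rewrite /separated_pair /= finset.setU0 dotBl.
rewrite (_ : indicator R finset.set0 = 0) ?dot0l ?subr0 -?coordsumE.
  apply; apply/and3P; split; [|exact/eqP|exact/eqP].
  by rewrite -setI_eq0 finset.setI0.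
by apply/rowP => i; rewrite !mxE inE.
Qed.

Lemma generic_balance y K : y != 0 -> generic y -> balance K y <> 0.
Proof.
move=> y0 [Hy gy]; pose A := [set i | 0 < y 0 i]%SET.
have := gy (K :&: A, A :\: K)%SET; rewrite /separated_pair /=.
have -> : (K :&: A :|: A :\: K = A)%SET by rewrite finset.setIC finset.setID.
rewrite (_ : dot _ y = balance K y); last first.
  apply: eq_bigr => i _; rewrite !mxE !inE.
  have [yi|yi] := ltP 0 (y 0 i); rewrite ?andbF ?andbT ?(subrr, mulr0, mul0r)//.
  by rewrite /sign; case: (i \in K); rewrite /= ?subr0 ?sub0r.
apply; apply/and3P; split.
- by rewrite -setI_eq0; apply/eqP/finset.setP => i; rewrite !inE; case: (i \in K); rewrite /= ?andbF.
- apply/eqP => A0; have := mass_gt0 Hy y0; rewrite /mass big1 ?ltxx// => i _.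
  apply: pos_eq0; rewrite leNgt; apply/negP => yi.
  by move/finset.setP/(_ i): A0; rewrite !inE yi.
apply/eqP => AT; have := mass_gt0 Hy y0; rewrite -massN// /mass big1 ?ltxx// => i _.
apply: pos_eq0; rewrite mxE oppr_le0; apply: ltW.
by move/finset.setP/(_ i): AT; rewrite !inE.
Qed.

Lemma generic_linear y : y != 0 -> generic y -> L y.
Proof.
move=> y0 gy; apply: (max_region_linear (w := codes_of y)).
apply: unbalanced_relint; first by case: gy.
move=> K []; first exact: generic_balance.
by apply: generic_balance; [rewrite oppr_eq0|apply: genericN].
Qed.

End Density.

(** * The case d = 2, where H is a line *)

Section Ray.
Variable R : realType.

Lemma code_of_scale d (x : 'rV[R]_d) c : 0 < c -> code_of (c *: x) = code_of x.
Proof.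
move=> c0; apply/ffunP => K; rewrite !ffunE /balance.
by rewrite (posZ _ (ltW c0)) dotZr pmulr_rge0.
Qed.

(** On a line the resonance code selects a ray, and codes are invariant under positive scaling. This
    replaces the information that [region_slopes] does not carry when d = 2. *)
Lemma codes_of_ray d (x y : 'rV[R]_d) : d = 2 ->
  resonance_complement x -> resonance_complement y ->
  resonance_code x = resonance_code y -> codes_of x = codes_of y.
Proof.
move=> d_eq2; subst d => -[Hx Ux] [Hy Uy].
pose i : 'I_2 := ord0; pose j : 'I_2 := lift ord0 ord0.
have jE (z : 'rV[R]_2) : H z -> z 0 j = - z 0 i.
  by move=> /H_dot; rewrite /dot !big_ord_recl big_ord0 addr0 !mxE -/i -/j; lra.
have s1 (z : 'rV[R]_2) : coordsum z [set i]%SET = z 0 i by rewrite /coordsum big_set1.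
have i0 : [set i]%SET <> finset.set0 by move=> /finset.setP/(_ i); rewrite !inE eqxx.
have iT : [set i]%SET <> [set: 'I_2]%SET by move=> /finset.setP/(_ j); rewrite !inE.
have := Ux _ i0 iT; have := Uy _ i0 iT; rewrite !s1 => yi xi.
move=> /ffunP/(_ [set i]%SET); rewrite !ffunE !s1 => sxy.
have c0 : 0 < y 0 i / x 0 i.
  have [x0|x0] := leP 0 (x 0 i); move: sxy.
    rewrite x0 => /esym y0; rewrite divr_gt0// lt_neqAle eq_sym ?x0 ?y0 andbT; exact/eqP.
  by rewrite leNgt x0 => /esym/negbT; rewrite -ltNge => y0; rewrite -mulrNN -invrN divr_gt0 ?oppr_gt0.
have -> : y = (y 0 i / x 0 i) *: x.
  apply/rowP => k; rewrite mxE.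
  have [->|kj] : k = i \/ k = j.
  - by case: k => -[|[|]]// lt2; [left|right]; apply: val_inj.
  - by rewrite divfK//; apply/eqP.
  by rewrite kj !jE// mulrN divfK//; apply/eqP.
by rewrite /codes_of -scalerN !code_of_scale.
Qed.

End Ray.

(** * Cells, and the reduction of the theorem to a statement about regular points *)

Section Cells.
Variables (R : realType) (d : nat) (d2 : (1 < d)%N).
Local Notation V := 'rV[R]_d.
Local Notation H := (@H R d).
Local Notation L := (linearity_locus (@p R d)).
Local Notation U := (@resonance_complement R d).
Local Notation region := (max_region (@region_slopes R d)).
Local Notation chamber := (max_region (@resonance_slope R d)).
Implicit Types (a b x y v : V) (I J K : {set 'I_d}).

(** Under the hypothesis of [bisection_fan_cells] these are exactly the points in general
    position. *)
Definition regular : set V := L `&` U.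

Lemma regular_dense x e : H x -> 0 < e -> exists2 y, regular y & box x e y.
Proof.
move=> Hx e0; have [y gy xy] := generic_dense Hx e0; exists y => //.
have Uy := generic_resonance gy.
by split=> //; apply: generic_linear => //; apply: resonance_neq0 Uy.
Qed.

Definition cell a : set V := region (codes_of a) `&` chamber (resonance_code a).

Lemma cell_polyhedral a : polyhedral_cone (cell a).
Proof. by apply: polyhedralI; apply: max_region_polyhedral. Qed.

Definition same_cell a b :=
  codes_of a = codes_of b /\ resonance_code a = resonance_code b.

Lemma same_cellE a b : same_cell a b -> cell a = cell b.
Proof. by rewrite /cell => -[-> ->]. Qed.

Lemma cell_relint a : regular a -> relint (cell a) a.
Proof.
by move=> [La Ua]; apply/relintI; split; [apply: region_relint|apply: resonance_relint].
Qed.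

Lemma relint_cell_regular a : relint (cell a) `<=` regular.
Proof.
by move=> x /relintI[/region_sub Lx /max_region_resonance_sub Ux].
Qed.

Lemma codes_of_eq x y : regular x -> regular y ->
  resonance_code x = resonance_code y -> region (codes_of x) y ->
  codes_of x = codes_of y.
Proof.
move=> [Lx Ux] [Ly Uy] rxy; have [d_eq2|d_ne2] := eqVneq d 2.
  by move=> _; apply: codes_of_ray.
rewrite (_ : @region_slopes R d = @slopes R d); last first.
  by apply/funext => w; rewrite /region_slopes (negbTE d_ne2).
move=> /max_region_slopesP[_ /= e1 e2].
(* A slope attaining [total z] has the signs of the balances of [z] by [slope_eq], and these are
   nonzero. *)
have key (w : code d) z : (forall K, balance K z <> 0) ->
    dot (slope R w) z = total z -> w = code_of z.
  move=> z0 e; apply/ffunP => K; have := slope_eq K e; have := normr_ge0 (balance K z).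
  rewrite ffunE /sign; case: (w K) => h1 h2; first by apply/esym; lra.
  apply/esym/negbTE; rewrite -ltNge lt_neqAle; apply/andP.
  by split; [apply/eqP/z0|lra].
have y0 := resonance_neq0 d2 Uy.
rewrite /codes_of; congr (_, _); apply: key => // K e.
  by apply: (linear_unbalanced (K := K) Ly y0); left.
by apply: (linear_unbalanced (K := K) Ly y0); right.
Qed.

Lemma cell_same a b : regular a -> regular b -> cell a b -> same_cell a b.
Proof.
move=> ra rb [ab cab]; have e : resonance_code a = resonance_code b.
  by apply: resonance_code_eq => //; [case: ra|case: rb].
by split=> //; apply: codes_of_eq.
Qed.

Local Notation fan := (common_refinement (linearity_fan R d) (resonance_fan R d)).

Lemma refinement_fan : polyhedral_fan fan.
Proof.
apply: common_refinement_fan.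
  apply: (induced_fan_max_region (q := @region_slopes R d)) => x Lx.
  by exists (codes_of x); apply: region_component.
apply: (induced_fan_max_region (q := @resonance_slope R d)) => x Ux.
by exists (resonance_code x); apply: resonance_component.
Qed.

Lemma cell_in_fan a : regular a -> fan (cell a).
Proof.
move=> [La Ua]; exists (region (codes_of a)), (chamber (resonance_code a)); split=> //.
  exists a => //; rewrite region_component//.
  exact/face_refl/max_region_polyhedral.
exists a => //; rewrite resonance_component//.
exact/face_refl/max_region_polyhedral.
Qed.

(** Points near a regular point share its cell, so regular points are in general position.
    Conversely, near a point in general position all regular points have one common cell; being
    closed, this cell contains a whole neighbourhood, and interior points of cells are regular. *)
Lemma bisection_fan_cells (P : set V) :
  (forall a b, regular a -> regular b ->
     bis_equiv P 0 a 0 b <-> same_cell a b) ->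
  (forall x e, H x -> 0 < e -> exists2 y, general_position P y & box x e y) /\
  is_bisection_fan P fan.
Proof.
move=> equivP; have gp_reg : general_position P = regular.
  apply/seteqP; split=> a; last first.
    move=> ra; have Ha : H a by case: ra => -[].
    split=> //; have [e e0 re] := relint_open (cell_relint ra).
    apply/nearHP; exists e => // y Hy /(re y Hy) ry; apply/equivP => //.
      exact: relint_cell_regular ry.
    apply: cell_same => //; first exact: relint_cell_regular ry.
    exact: relint_sub ry.
  move=> [Ha /nearHP[e e0 ae]].
  have [b rb ab] := regular_dense Ha e0; have Hb : H b by case: rb => -[].
  apply: (@relint_cell_regular b); apply/relintP; split=> //; exists e => // y Hy ay.
  apply: (polyhedral_closed (cell_polyhedral b)); apply/closureP => f f0.
  have [r r0 ry] : exists2 r, 0 < r & box y r `<=` box a e.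
    pose r := \big[Num.min/1]_i (e - `|y 0 i - a 0 i|).
    exists r; first by apply: lt_bigmin => // i _; rewrite subr_gt0 ay.
    move=> z yz i; have ri : r <= e - `|y 0 i - a 0 i| by apply: bigmin_le_cond.
    have := ler_normD (z 0 i - y 0 i) (y 0 i - a 0 i); have := yz i.
    by rewrite addrA subrK; lra.
  have m0 : 0 < Num.min r f by rewrite lt_min r0.
  have [c rc yc] := regular_dense Hy m0; have Hc : H c by case: rc => -[].
  exists c; last by apply: box_le yc; rewrite ge_min lexx orbT.
  (* Both [b] and [c] lie in the box around [a] where the bisector is equivalent to that of [a]. *)
  have -> : cell b = cell c.
    apply/same_cellE/equivP => // F G fF fG; rewrite -(ae b Hb ab F G fF fG).
    by apply: ae => //; apply: ry; apply: box_le yc; rewrite ge_min lexx.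
  by apply: relint_sub; apply: cell_relint.
rewrite gp_reg; split; first exact: regular_dense.
have fan_fan := refinement_fan; split=> // a b; rewrite gp_reg => ra rb.
rewrite equivP//; split=> [ab|[C [mC raC rbC]]].
  exists (cell a); split.
  - exact: (fan_maximal fan_fan (cell_in_fan ra) (cell_relint ra)).
  - exact: cell_relint.
  - by rewrite (same_cellE ab); apply: cell_relint.
apply: cell_same => //; have [fC maxC] := mC.
have Ca := cell_in_fan ra; suff -> : cell a = C by apply: relint_sub.
apply: maxC => //; apply: (fan_meet_eq fan_fan fC Ca raC).
by apply: relint_sub; apply: cell_relint.
Qed.

End Cells.

(** * Facets of the root polytope *)

Section Polytope.
Variables (R : realType) (d : nat) (d2 : (1 < d)%N).
Local Notation V := 'rV[R]_d.
Local Notation H := (@H R d).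
Local Notation P := (root_polytope R d).
Implicit Types (x y v c : V) (I J K : {set 'I_d}) (F : set V).

Lemma coordsum_root i j I :
  coordsum (delta_mx 0 i - delta_mx 0 j : V) I = (i \in I)%:R - (j \in I)%:R.
Proof. by rewrite coordsumE dotBr !dot_delta !mxE. Qed.

Lemma massE x : mass x = coordsum x [set i | 0 < x 0 i]%SET.
Proof.
rewrite /coordsum big_mkcond; apply: eq_bigr => i _; rewrite inE.
by have [xi|xi] := ltP 0 (x 0 i); [rewrite pos_id ?ltW|rewrite pos_eq0].
Qed.

Lemma coordsum_le_mass x I : coordsum x I <= mass x.
Proof.
rewrite /coordsum big_mkcond; apply: ler_sum => i _.
by case: ifP => _; [apply: pos_ge|apply: pos_ge0].
Qed.

Lemma coordsumC x I : H x -> coordsum x (~: I)%SET = - coordsum x I.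
Proof.
move=> /H_dot; rewrite !coordsumE => Hx; apply/eqP; rewrite -addr_eq0 -dotDl.
by rewrite -[X in _ == X]Hx; apply/eqP; congr dot; apply/rowP => i;
  rewrite !mxE inE; case: (i \in I); rewrite /= ?addr0 ?add0r.
Qed.

Lemma conv_finType (A : set V) (T : finType) (v : T -> V) (c : T -> R) :
  (forall t, A (v t)) -> (forall t, 0 <= c t) -> \sum_t c t = 1 ->
  Defs.conv A (\sum_t c t *: v t).
Proof.
move=> Av c0 c1; exists #|T|, (v \o enum_val), (c \o enum_val).
split=> [i|i||]; [exact: Av|exact: c0| |].
  by rewrite -c1 (big_enum_val (A := T)).
by rewrite (big_enum_val (A := T)).
Qed.

Lemma conv_root i j : i != j -> Defs.conv [set v : V | exists i j : 'I_d, (i < j)%N /\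
    (v = basis_vec R i - basis_vec R j \/ v = - (basis_vec R i - basis_vec R j))]
  (delta_mx 0 i - delta_mx 0 j).
Proof.
move=> ij; exists 1%N, (fun=> delta_mx 0 i - delta_mx 0 j), (fun=> 1).
split=> //; rewrite ?big_ord1 ?scale1r// => _.
move: ij; rewrite neq_ltn => /orP[ij|ji]; first by exists i, j; split=> //; left.
by exists j, i; split=> //; right; rewrite opprB.
Qed.

(** A point of H is transported from its positive part to its negative part by the product coupling:
    the root [e_i - e_j] gets weight [x_i^+ x_j^- / mass x]. The remaining weight [1 - mass x] is
    split between two opposite roots. *)
Lemma polytopeP x : P x <-> H x /\ mass x <= 1.
Proof.
split=> [[n [v [c [Av c0 c1 ->]]]]|[Hx m1]].
  have vroot k : exists i j, v k = delta_mx 0 i - delta_mx 0 j.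
    by have [i [j [_ [->|->]]]] := Av k; [exists i, j|exists j, i; rewrite opprB].
  split.
    apply/H_dot; rewrite dot_sumr big1// => k _; rewrite dotZr.
    by have [i [j ->]] := vroot k; rewrite (H_dot _).1 ?mulr0//; apply: root_H.
  rewrite massE coordsumE dot_sumr -c1; apply: ler_sum => k _.
  rewrite dotZr -coordsumE; have [i [j ->]] := vroot k.
  rewrite coordsum_root ler_piMr//.
  by do 2!case: (_ \in _); rewrite /=; lra.
pose i0 : 'I_d := Ordinal (ltnW d2); pose j0 : 'I_d := Ordinal d2.
pose A := [set v : V | exists i j : 'I_d, (i < j)%N /\
    (v = basis_vec R i - basis_vec R j \/ v = - (basis_vec R i - basis_vec R j))].
pose r (i j : 'I_d) : V := delta_mx 0 i - delta_mx 0 j.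
have Ar i j : i != j -> A (r i j).
  rewrite neq_ltn => /orP[ij|ji]; first by exists i, j; split=> //; left.
  by exists j, i; split=> //; right; rewrite /r opprB.
(* A diagonal pair gets a dummy root; its weight is 0, since a coordinate is not both positive and
   negative. *)
pose v (t : ('I_d * 'I_d) + bool) := match t with
  | inl ij => if ij.1 == ij.2 then r i0 j0 else r ij.1 ij.2
  | inr b => if b then r i0 j0 else r j0 i0 end.
pose c (t : ('I_d * 'I_d) + bool) := match t with
  | inl ij => pos x 0 ij.1 * pos (- x) 0 ij.2 / mass x
  | inr b => (1 - mass x) / 2 end.
have mass_ge0 : 0 <= mass x by apply: sumr_ge0 => i _; apply: pos_ge0.
(* For mass 0 both sides vanish, as [x] is then 0. *)
have posm i : pos x 0 i * (mass x / mass x) = pos x 0 i.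
  have [m0|m0] := eqVneq (mass x) 0; last by rewrite divff// mulr1.
  by rewrite m0 mul0r mulr0 (mass0 Hx m0) pos_eq0// mxE.
have negm i : pos (- x) 0 i * (mass x / mass x) = pos (- x) 0 i.
  have [m0|m0] := eqVneq (mass x) 0; last by rewrite divff// mulr1.
  by rewrite m0 mul0r mulr0 (mass0 Hx m0) oppr0 pos_eq0// mxE.
have sumj i : \sum_j pos x 0 i * pos (- x) 0 j / mass x = pos x 0 i.
  by rewrite -mulr_suml -mulr_sumr -/(mass (- x)) massN// -mulrA posm.
have sumi j : \sum_i pos x 0 i * pos (- x) 0 j / mass x = pos (- x) 0 j.
  by rewrite -!mulr_suml -/(mass x) [mass x * _]mulrC -mulrA negm.
have := @conv_finType A _ v c.
suff -> : \sum_t c t *: v t = x.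
  apply.
  - by case=> [[i j]|[]]; rewrite /v /=; do ?case: ifPn => // *; apply: Ar.
  - by case=> [[i j]|b] /=; [rewrite divr_ge0// mulr_ge0 ?pos_ge0|lra].
  rewrite big_sumType /= big_bool /= -(pair_big xpredT xpredT (fun i j => pos x 0 i * pos (- x) 0 j / mass x)) /=.
  under eq_bigr do rewrite sumj.
  by rewrite -/(mass x); lra.
rewrite big_sumType /= big_bool /= -scalerDr /r -opprB addNr scaler0 addr0.
apply/rowP => k; rewrite summxE.
transitivity (\sum_i \sum_j (pos x 0 i * pos (- x) 0 j / mass x * (k == i)%:R -
    pos x 0 i * pos (- x) 0 j / mass x * (k == j)%:R)).
  rewrite pair_big /=; apply: eq_bigr => -[i j] _ /=.
  have [->|ij] := eqVneq i j; last by rewrite !mxE /= mulrBr.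
  rewrite subrr [LHS]mxE.
  have [xj|/ltW xj] := leP 0 (x 0 j); last by rewrite pos_eq0// !mul0r.
  by rewrite (@pos_eq0 _ _ (- x)) 1?mxE ?oppr_le0// mulr0 !mul0r.
under eq_bigr do rewrite sumrB.
rewrite sumrB -[RHS]posB; congr (_ - _).
  rewrite (bigD1 k)//= eqxx -mulr_suml sumj mulr1 big1 ?addr0// => i /negbTE ik.
  by rewrite -mulr_suml eq_sym ik mulr0.
rewrite exchange_big /= (bigD1 k)//= eqxx -mulr_suml sumi mulr1 big1 ?addr0// => i /negbTE ik.
by rewrite -mulr_suml eq_sym ik mulr0.
Qed.

Lemma polytope_root i j : i != j -> P (delta_mx 0 i - delta_mx 0 j).
Proof. exact: conv_root. Qed.

Definition orthant I : set V := [set x | H x /\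
  forall i, (i \in I -> 0 <= x 0 i) /\ (i \notin I -> x 0 i <= 0)].

Lemma orthant_mass I x : orthant I x -> coordsum x I = mass x.
Proof.
move=> [Hx Ix]; rewrite /coordsum big_mkcond; apply: eq_bigr => i _.
by case: ifPn => iI; [rewrite pos_id//; apply: (Ix i).1|rewrite pos_eq0//; apply: (Ix i).2].
Qed.

Lemma mass_orthant I x : H x -> mass x <= coordsum x I -> orthant I x.
Proof.
move=> Hx le_m; have ge0 i : true -> 0 <= pos x 0 i - (if i \in I then x 0 i else 0).
  by move=> _; rewrite subr_ge0; case: ifP => _; [apply: pos_ge|apply: pos_ge0].
have e0 : \sum_i (pos x 0 i - (if i \in I then x 0 i else 0)) = 0.
  apply/eqP; rewrite eq_le sumr_ge0// andbT sumrB -big_mkcond subr_le0.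
  exact: le_m.
split=> // i; have := psumr_eq0P ge0 e0 (i := i) isT.
case: ifPn => iI e; split=> // _.
  by rewrite -(subr0_eq e) pos_ge0.
by rewrite (le_trans (pos_ge x i))//; lra.
Qed.

Definition facet I : set V := [set x | P x /\ coordsum x I = 1].

Definition proper I := I <> finset.set0 /\ I <> [set: 'I_d]%SET.

Lemma properC I : proper I -> proper (~: I)%SET.
Proof.
move=> [I0 IT]; split=> e; [apply: IT|apply: I0];
  by rewrite -[I]finset.setCK e ?finset.setC0 ?finset.setCT.
Qed.

Lemma facet_root I i j : i \in I -> j \notin I ->
  facet I (delta_mx 0 i - delta_mx 0 j).
Proof.
move=> iI jI; split; last by rewrite coordsum_root iI (negbTE jI) subr0.
by apply: polytope_root; apply: contraNneq jI => <-.
Qed.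

Lemma facet_face I : proper I -> is_face (facet I) P /\ facet I <> P.
Proof.
move=> [I0 IT]; have [i [j [iI jI]]] := proper_separated I0 IT.
split; last first.
  move=> fP; have ji : j != i by apply: contraNneq jI => ->.
  have := polytope_root ji; rewrite -fP => -[_].
  by rewrite coordsum_root iI (negbTE jI) /=; lra.
split; first by exists (delta_mx 0 i - delta_mx 0 j); apply: facet_root.
exists (dot (indicator R I)); apply/seteqP; split=> x [Px lx]; split=> //=.
  move=> y /polytopeP[_ my]; rewrite -!coordsumE lx.
  exact: le_trans (coordsum_le_mass _ _) my.
have [Pr cr] := facet_root iI jI; have := lx _ Pr; rewrite /= -!coordsumE cr.
have /polytopeP[_ mx] := Px; have := coordsum_le_mass x I; lra.
Qed.

(* A linear functional v is at most max v - min v on P, with equality only if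
   the positive coordinates sit where v is maximal and the negative ones where
   it is minimal. *)
Lemma face_sub_facet F : is_face F P -> F <> P -> exists2 I, proper I & F `<=` facet I.
Proof.
move=> [_ [l ->]] FP; have [v lv] := scalar_dot l.
have i0 : 'I_d := Ordinal d2.
have [i imax] : exists i, forall k, v 0 k <= v 0 i.
  have [i _ imax] := @arg_maxP _ _ _ i0 xpredT (fun i => v 0 i) isT.
  by exists i => k; apply: imax.
have [j jmin] : exists j, forall k, v 0 j <= v 0 k.
  have [j _ jmin] := @arg_minP _ _ _ i0 xpredT (fun i => v 0 i) isT.
  by exists j => k; apply: jmin.
have [vij|vij] := eqVneq (v 0 i) (v 0 j).
  case: FP; apply/seteqP; split=> [x []//|x Px]; split=> // y Py; rewrite !lv.
  have cst z : P z -> dot v z = 0.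
    move=> /polytopeP[/H_dot Hz _]; rewrite -[RHS](mulr0 (v 0 i)) -Hz -dotZl.
    congr dot; apply/rowP => k; rewrite !mxE mulr1; apply/eqP; rewrite eq_le.
    by rewrite imax// vij jmin.
  by rewrite !cst.
have ltji : v 0 j < v 0 i by rewrite lt_neqAle eq_sym vij jmin.
have ij : i != j by apply: contraNneq vij => ->.
exists [set k | v 0 k == v 0 i]%SET.
  split; first by move=> /finset.setP/(_ i); rewrite !inE eqxx.
  by move=> /finset.setP/(_ j); rewrite !inE eq_sym (negbTE vij).
move=> x [Px lx]; split=> //; have /polytopeP[Hx mx] := Px.
have := lx _ (polytope_root ij); rewrite !lv dotBr !dot_delta => le_vx.
have t1 k : 0 <= pos x 0 k * (v 0 i - v 0 k).
  by rewrite mulr_ge0 ?pos_ge0// subr_ge0 imax.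
have t2 k : 0 <= pos (- x) 0 k * (v 0 k - v 0 j).
  by rewrite mulr_ge0 ?pos_ge0// subr_ge0 jmin.
have s1 : \sum_k pos x 0 k * (v 0 i - v 0 k) = mass x * v 0 i - dot v (pos x).
  rewrite /mass mulr_suml /dot -sumrB; apply: eq_bigr => k _.
  by rewrite mulrBr [v 0 k * _]mulrC.
have s2 : \sum_k pos (- x) 0 k * (v 0 k - v 0 j) = dot v (pos (- x)) - mass x * v 0 j.
  rewrite -(massN Hx) /mass mulr_suml /dot -sumrB; apply: eq_bigr => k _.
  by rewrite mulrBr [v 0 k * _]mulrC.
have vx : dot v x = dot v (pos x) - dot v (pos (- x)).
  by rewrite -dotBr; congr dot; apply/rowP => k; rewrite [RHS]mxE [(- pos _) 0 k]mxE posB.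
(* These three nonnegative gaps add up to [v_i - v_j - dot v x], which is at most 0 by maximality of
   [x], so each of them is 0. *)
have g1 : 0 <= \sum_k pos x 0 k * (v 0 i - v 0 k) by apply: sumr_ge0.
have g2 : 0 <= \sum_k pos (- x) 0 k * (v 0 k - v 0 j) by apply: sumr_ge0.
have g3 : 0 <= (1 - mass x) * (v 0 i - v 0 j) by rewrite mulr_ge0 ?subr_ge0 // ltW.
have z1 : \sum_k pos x 0 k * (v 0 i - v 0 k) = 0 by lra.
have z2 : \sum_k pos (- x) 0 k * (v 0 k - v 0 j) = 0 by lra.
have m1 : mass x = 1.
  have : (1 - mass x) * (v 0 i - v 0 j) == 0 by apply/eqP; lra.
  by rewrite mulf_eq0 => /orP[|]; rewrite subr_eq0 => /eqP // e; rewrite e eqxx in vij.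
rewrite -m1; apply: orthant_mass; split=> // k; rewrite inE; split=> [/eqP vk|vk].
  have := psumr_eq0P (fun k _ => t2 k) z2 (i := k) isT; rewrite vk => /eqP.
  rewrite mulf_eq0 subr_eq0 (negbTE vij) orbF => /eqP nk.
  by rewrite -posB nk subr0 pos_ge0.
have := psumr_eq0P (fun k _ => t1 k) z1 (i := k) isT => /eqP.
rewrite mulf_eq0 subr_eq0 [v 0 i == _]eq_sym (negbTE vk) orbF => /eqP nk.
by rewrite (le_trans (pos_ge x k))// nk.
Qed.

(** Every proper face lies in some [facet J]. No inclusion between different ones is possible,
    because the roots in [facet I] separate exactly the elements of [I] from the others. *)
Lemma facetP F : is_facet F P <-> exists2 I, proper I & F = facet I.
Proof.
split=> [[fF FP maxF]|[I pI ->]].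
  have [I pI FI] := face_sub_facet fF FP; exists I => //.
  by have [fI IP] := facet_face pI; rewrite (maxF _ fI IP FI).
have [fI IP] := facet_face pI; split=> // F' fF' F'P IF'.
have [J pJ F'J] := face_sub_facet fF' F'P; suff IJ : I = J.
  by apply/seteqP; split=> //; rewrite IJ.
have [[I0 IT] [J0 JT]] := (pI, pJ).
have [i [j [iI jI]]] := proper_separated I0 IT.
have IJ k l : k \in I -> l \notin I -> k \in J /\ l \notin J.
  move=> kI lI; have [_] := F'J _ (IF' _ (facet_root kI lI)).
  by rewrite coordsum_root; do 2!case: (_ \in J) => //=; lra.
apply/finset.setP => k; apply/idP/idP => kI; first by case: (IJ k j kI jI).
by apply/negPn/negP => kI'; have [_] := IJ i k iI kI'; rewrite kI.
Qed.

Lemma cone_facet I : proper I -> Defs.cone (facet I) = orthant I.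
Proof.
move=> [I0 IT]; apply/seteqP; split=> x.
  move=> [n [v [c [fv c0 ->]]]].
  have ov k : orthant I (v k).
    have [/polytopeP[Hv mv] cv] := fv k; apply: mass_orthant => //.
    by rewrite cv.
  split.
    apply/H_dot; rewrite dot_sumr big1// => k _; rewrite dotZr.
    by have [/H_dot -> _] := ov k; rewrite mulr0.
  move=> i; split=> iI; rewrite summxE.
    by apply: sumr_ge0 => k _; rewrite mxE mulr_ge0//; apply: ((ov k).2 i).1.
  by apply: sumr_le0 => k _; rewrite mxE mulr_ge0_le0//; apply: ((ov k).2 i).2.
move=> ox; have [Hx Ix] := ox.
have [m0|m0] := eqVneq (mass x) 0.
  exists 0%N, (fun=> 0), (fun=> 0); split; [by case|by case|].
  by rewrite big_ord0; apply: mass0.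
have mp : 0 < mass x by rewrite lt_neqAle eq_sym m0 sumr_ge0// => i _; apply: pos_ge0.
exists 1%N, (fun=> (mass x)^-1 *: x), (fun=> mass x); split=> // [_|_|].
- split; last by rewrite coordsumE dotZr -coordsumE orthant_mass// mulVf.
  apply/polytopeP; split; first exact: HZ.
  by rewrite massZ ?mulVf// invr_ge0 ltW.
- exact: ltW.
by rewrite big_ord1 scalerA divff// scale1r.
Qed.

Lemma distE a b : H (b - a) -> dist P a b = mass (b - a).
Proof.
move=> Hab; rewrite /dist; set S := [set t : R | _ /\ exists2 v, _ & _].
have mS : S (mass (b - a)).
  split; first by apply: sumr_ge0 => i _; apply: pos_ge0.
  have [m0|m0] := eqVneq (mass (b - a)) 0.
    exists 0; last by rewrite (mass0 Hab m0) scaler0.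
    apply/polytopeP; split; first exact: H0.
    by rewrite -(mass0 Hab m0) m0.
  exists ((mass (b - a))^-1 *: (b - a)); last by rewrite scalerA divff// scale1r.
  apply/polytopeP; split; first exact: HZ.
  by rewrite massZ ?mulVf// invr_ge0 sumr_ge0// => i _; apply: pos_ge0.
have lbm : lbound S (mass (b - a)).
  move=> t [t0 [v /polytopeP[_ mv] ->]]; rewrite massZ//.
  by rewrite ler_piMr.
have := @xgetPex _ 0 [set t | S t /\ lbound S t] (ex_intro _ _ (conj mS lbm)).
set g := xget _ _ => -[Sg lbg]; apply/eqP; rewrite eq_le.
by rewrite (lbg _ mS) (lbm _ Sg).
Qed.

Definition meets I J c := exists x, [/\ orthant I x, orthant J (x - c) & mass x = mass (x - c)].

Lemma bis_facetsP I J c : proper I -> proper J -> H c ->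
  bis_facets P (facet I) (facet J) 0 c !=set0 <-> meets I J c.
Proof.
move=> pI pJ Hc; rewrite /bis_facets !cone_facet//; split=> [[x [[[Hx] + ox] oxc]]|[x [ox oxc e]]].
  rewrite !distE ?subr0//; last exact: HB.
  by move=> e; exists x; split=> //; move: ox; rewrite /= subr0.
have [Hx _] := ox; exists x; split; last by [].
split; last by rewrite /= subr0.
by split=> //; rewrite !distE ?subr0//; apply: HB.
Qed.

Lemma bis_equivP a b : H a -> H b -> bis_equiv P 0 a 0 b <->
  forall I J, proper I -> proper J -> meets I J a <-> meets I J b.
Proof.
move=> Ha Hb; split=> [ab I J pI pJ|ab F G /facetP[I pI ->] /facetP[J pJ ->]].
  by rewrite -!bis_facetsP//; apply: ab; apply/facetP; [exists I|exists J].
by rewrite !bis_facetsP//; apply: ab.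
Qed.

End Polytope.

(** * Bisectors *)

Section Meeting.
Variables (R : realType) (d : nat).
Local Notation V := 'rV[R]_d.
Local Notation H := (@H R d).
Implicit Types (x y v c a b : V) (I J K : {set 'I_d}).

Lemma orthantC I x : orthant I x -> orthant (~: I)%SET (- x).
Proof.
move=> [Hx Ix]; split=> [|i]; first exact: HN.
rewrite inE negbK mxE oppr_ge0 oppr_le0.
by have [h1 h2] := Ix i; split.
Qed.

(** Negation exchanges index sets with their complements; it reduces the case where [I] and [J]
    cover everything to the disjoint case. *)
Lemma meetsN I J c : H c -> meets I J c -> meets (~: I)%SET (~: J)%SET (- c).
Proof.
move=> Hc [x [ox oxc e]]; exists (- x); rewrite -opprD.
have [[Hx _] [Hxc _]] := (ox, oxc).
by split; [apply: orthantC|apply: orthantC|rewrite !massN].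
Qed.

Lemma balance_pos K c : (forall i, i \in K -> 0 <= c 0 i) ->
  balance K c = 2 * coordsum c K - mass c.
Proof.
move=> cK; rewrite /balance /dot /mass /coordsum [\sum_(i in K) _]big_mkcond mulr_sumr -sumrB.
apply: eq_bigr => i _; rewrite [signvec _ _ _ _]mxE /sign.
by case: ifP => iK; [rewrite pos_id ?cK//|]; lra.
Qed.

Lemma coordsumN c K : coordsum (- c) K = - coordsum c K.
Proof. by rewrite !coordsumE dotNr. Qed.

Lemma coordsumB x y K : coordsum (x - y) K = coordsum x K - coordsum y K.
Proof. by rewrite !coordsumE dotBr. Qed.

(** Necessity: [mass c <= mass x + mass (c - x) = 2 * mass x], while [mass x] is at most [c(I)] and
    at most [- c(J)]. Sufficiency scales [c] on [I] and on [J] so that both distances equal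
    [mass c / 2]. *)
Lemma meets_disjoint I J c : H c -> [disjoint I & J]%B ->
  meets I J c <-> [/\ forall i, i \in I -> 0 <= c 0 i,
    forall i, i \in J -> c 0 i <= 0, 0 <= balance I c & 0 <= balance J (- c)].
Proof.
move=> Hc dIJ; have nJ i : i \in I -> i \notin J by move=> iI; rewrite (disjointFr dIJ iI).
have nI i : i \in J -> i \notin I by move=> iJ; rewrite (disjointFl dIJ iJ).
have oppE (z : V) i : (- z) 0 i = - z 0 i by rewrite mxE.
split=> [[x [ox oxc e]]|[cI cJ bI bJ]].
  have [[Hx Ix] [Hxc Jxc]] := (ox, oxc).
  have leI i : i \in I -> 0 <= x 0 i /\ x 0 i <= c 0 i.
    move=> iI; split; first exact: (Ix i).1.
    by have := (Jxc i).2 (nJ i iI); rewrite mxE oppE; lra.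
  have leJ i : i \in J -> x 0 i <= 0 /\ c 0 i <= x 0 i.
    move=> iJ; split; first exact: (Ix i).2 (nI i iJ).
    by have := (Jxc i).1 iJ; rewrite mxE oppE; lra.
  have cI i : i \in I -> 0 <= c 0 i by move=> /leI[]; lra.
  have cJ i : i \in J -> c 0 i <= 0 by move=> /leJ[]; lra.
  have mc : mass c <= 2 * mass x.
    have := massD x (- (x - c)); rewrite massN// -e opprB addrC subrK; lra.
  have sI : mass x <= coordsum c I.
    by rewrite -(orthant_mass ox); apply: ler_sum => i /leI[].
  have sJ : mass x <= coordsum (- c) J.
    rewrite e -(orthant_mass oxc); apply: ler_sum => i iJ; rewrite mxE !oppE.
    by have [] := leJ i iJ; lra.
  split=> //; rewrite balance_pos ?massN//; try lra.
  by move=> i /cJ; rewrite oppE oppr_ge0.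
have [m0|m0] := eqVneq (mass c) 0.
  have c0 := mass0 Hc m0; have o0 K : orthant K (0 : V).
    by split=> [|i]; [apply: H0|rewrite mxE].
  by exists 0; rewrite c0 subr0.
have mp : 0 < mass c by rewrite lt_neqAle eq_sym m0 sumr_ge0// => i _; apply: pos_ge0.
rewrite balance_pos// in bI.
rewrite balance_pos ?massN// in bJ; last by move=> i /cJ; rewrite oppE oppr_ge0.
rewrite coordsumN in bJ; set sI := coordsum c I in bI; set sJ := coordsum c J in bJ.
(* These factors give [x(I)] and [(x - c)(J)] the value [mass c / 2]; the balance conditions say
   that [s <= 1] and [-1 <= r]. *)
pose s := mass c / (2 * sI); pose r := mass c / (2 * sJ).
have [sI0 sJ0] : 0 < sI /\ sJ < 0 by split; lra.
have s01 : 0 <= s <= 1.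
  apply/andP; split; first by apply: divr_ge0; lra.
  by rewrite ler_pdivrMr; lra.
have r01 : -1 <= r <= 0.
  rewrite /r -mulrNN -invrN mulNr oppr_le0 lerN2; apply/andP; split.
    by rewrite ler_pdivrMr; lra.
  by apply: divr_ge0; lra.
have ssI : s * sI = mass c / 2 by rewrite /s; field; rewrite gt_eqF.
have rsJ : r * sJ = mass c / 2 by rewrite /r; field; rewrite lt_eqF.
(* On [J] this is [(r + 1) * c], and off both sets it is minus the negative part of [c], which makes
   the coordinates sum to 0. *)
pose x : V := \row_i ((i \in I)%:R * (s * c 0 i) + (i \in J)%:R * (r * c 0 i) - pos (- c) 0 i).
have xI i : i \in I -> x 0 i = s * c 0 i.
  move=> iI; rewrite mxE iI (negbTE (nJ i iI)) /= pos_eq0 ?oppE ?oppr_le0 ?cI//.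
  by rewrite mul1r mul0r addr0 subr0.
have xJ i : i \in J -> x 0 i = (r + 1) * c 0 i.
  move=> iJ; rewrite mxE iJ (negbTE (nI i iJ)) /= pos_id ?oppE ?oppr_ge0 ?cJ//.
  by ring.
have xQ i : i \notin I -> i \notin J -> x 0 i = - pos (- c) 0 i.
  by move=> /negbTE iI /negbTE iJ; rewrite mxE iI iJ /= !mul0r !add0r.
have Hx : H x.
  apply/H_dot; transitivity (s * sI + r * sJ - mass (- c)).
    rewrite /sI /sJ !coordsumE /dot !mulr_sumr /mass -big_split -sumrB /=.
    by apply: eq_bigr => i _; rewrite !mxE; ring.
  by rewrite ssI rsJ massN//; lra.
have Hxc : H (x - c) by apply: HB.
have /andP[s0 s1] := s01; have /andP[r0 r1] := r01.
have ox : orthant I x.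
  split=> // i; split=> iI; first by rewrite xI// mulr_ge0 ?cI.
  have [iJ|iJ] := boolP (i \in J).
    by rewrite xJ// mulr_ge0_le0 ?cJ//; lra.
  by rewrite xQ// oppr_le0 pos_ge0.
have oxc : orthant J (x - c).
  split=> // i; rewrite mxE oppE; split=> iJ.
    by rewrite xJ// (_ : _ - _ = r * c 0 i); [rewrite mulr_le0 ?cJ|ring].
  have [iI|iI] := boolP (i \in I).
    by rewrite xI// (_ : _ - _ = (s - 1) * c 0 i); [rewrite mulr_le0_ge0 ?cI//; lra|ring].
  rewrite xQ// -opprD oppr_le0.
  by have := posB c i; have := pos_ge0 c i; lra.
exists x; split=> //; rewrite -(orthant_mass ox) -(orthant_mass oxc).
transitivity (s * sI).
  by rewrite /sI /coordsum mulr_sumr; apply: eq_bigr => i /xI.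
rewrite ssI -rsJ /sJ /coordsum mulr_sumr; apply: eq_bigr => i iJ.
by rewrite mxE oppE xJ//; ring.
Qed.

(** The coordinate [p] may grow and [q] may decrease without leaving either orthant, so the sum of
    coordinates can be corrected freely. What remains is the equality of the distances,
    [x(I) - x(J) = - c(J)]. *)
Lemma meets_overlap I J c p q : H c -> p \in I -> p \in J -> q \notin I -> q \notin J ->
  meets I J c <-> [/\ forall i, i \in I -> i \notin J -> 0 <= c 0 i,
    forall i, i \in J -> i \notin I -> c 0 i <= 0,
    coordsum c J <= 0 & 0 <= coordsum c I].
Proof.
move=> Hc pI pJ qI qJ; have oppE (z : V) i : (- z) 0 i = - z 0 i by rewrite mxE.
split=> [[x [ox oxc e]]|[cI cJ sJ sI]].
  have [[Hx Ix] [Hxc Jxc]] := (ox, oxc); split.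
  - move=> i iI iJ; have := (Ix i).1 iI; have := (Jxc i).2 iJ.
    by rewrite mxE oppE; lra.
  - move=> i iJ iI; have := (Ix i).2 iI; have := (Jxc i).1 iJ.
    by rewrite mxE oppE; lra.
  - have := orthant_mass oxc; rewrite coordsumB -e.
    by have := coordsum_le_mass x J; lra.
  - have := orthant_mass ox; rewrite e.
    by have := coordsum_le_mass (x - c) I; rewrite coordsumB; lra.
set SI := coordsum c I in sI; set SJ := coordsum c J in sJ.
(* With [x = t c] on the symmetric difference of [I] and [J], this equation says that the distances
   agree. If [SI = SJ], both are 0. *)
have [t [t0 t1 tE]] : exists t, [/\ 0 <= t, t <= 1 & t * (SI - SJ) = - SJ].
  have [S0|S0] := eqVneq (SI - SJ) 0.
    by exists 0; split=> //; rewrite ?ler01// mul0r; lra.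
  have Sp : 0 < SI - SJ by rewrite lt_neqAle eq_sym S0; lra.
  exists (- SJ / (SI - SJ)); split; last by rewrite divfK.
    by apply: divr_ge0; lra.
  by rewrite ler_pdivrMr//; lra.
pose y : V := \row_i (if i \in I then (if i \in J then pos c 0 i else t * c 0 i)
  else (if i \in J then t * c 0 i else - pos (- c) 0 i)).
pose m := \sum_i y 0 i.
(* The corrections at [p] and at [q] that bring the point back to H. *)
pose u := Num.max (- m) 0; pose w := Num.max m 0.
have [u0 w0 uw] : [/\ 0 <= u, 0 <= w & m + u - w = 0].
  rewrite /u /w; have [m0|/ltW m0] := leP 0 m.
    by rewrite max_r ?oppr_le0//; split=> //; lra.
  by rewrite max_l ?oppr_ge0//; split=> //; lra.
pose x : V := y + u *: delta_mx 0 p - w *: delta_mx 0 q.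
have xE i : x 0 i = y 0 i + u * (i == p)%:R - w * (i == q)%:R by rewrite !mxE.
have Hx : H x.
  apply/H_dot; rewrite dotBr dotDr !dotZr !dot_delta !mxE !mulr1 -[RHS]uw.
  by congr (_ + _ - _); apply: eq_bigr => i _; rewrite [const_mx 1 0 i]mxE mul1r.
have Hxc : H (x - c) by apply: HB.
have notp i : i \notin I \/ i \notin J -> (i == p) = false.
  by move=> h; apply/negbTE/eqP => ip; move: h; rewrite ip pI pJ => -[].
have notq i : i \in I \/ i \in J -> (i == q) = false.
  by move=> h; apply/negbTE/eqP => iq; move: h; rewrite iq (negbTE qI) (negbTE qJ) => -[].
have ox : orthant I x.
  split=> // i; rewrite xE mxE; split=> iI.
    rewrite iI notq ?mulr0 ?subr0; last by left.
    rewrite addr_ge0 ?mulr_ge0//; case: ifPn => iJ; first exact: pos_ge0.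
    by rewrite mulr_ge0// cI.
  rewrite (negbTE iI) notp ?mulr0 ?addr0; last by left.
  rewrite subr_le0 (@le_trans _ _ 0) ?mulr_ge0//.
  case: ifPn => iJ; last by rewrite oppr_le0 pos_ge0.
  by rewrite mulr_ge0_le0// cJ.
have oxc : orthant J (x - c).
  split=> // i; rewrite mxE xE oppE [y 0 i]mxE; split=> iJ.
    rewrite iJ notq ?mulr0 ?subr0; last by right.
    rewrite addrAC addr_ge0 ?mulr_ge0//; case: ifPn => iI; first by rewrite subr_ge0 pos_ge.
    rewrite (_ : _ - _ = (t - 1) * c 0 i); last by ring.
    by rewrite mulr_le0 ?cJ//; lra.
  rewrite (negbTE iJ) notp ?mulr0 ?addr0; last by right.
  rewrite addrAC subr_le0 (@le_trans _ _ 0) ?mulr_ge0//; case: ifPn => iI.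
    rewrite (_ : _ - _ = (t - 1) * c 0 i); last by ring.
    by rewrite mulr_le0_ge0 ?cI//; lra.
  by have := posB c i; have := pos_ge0 c i; lra.
exists x; split=> //; rewrite -(orthant_mass ox) -(orthant_mass oxc).
rewrite coordsumB -/SJ; suff : coordsum x I - coordsum x J = t * (SI - SJ) by rewrite tE; lra.
rewrite /SI /SJ !coordsumE -!dotBl -dotZr /dot; apply: eq_bigr => i _.
have -> : (indicator R I - indicator R J) 0 i = (i \in I)%:R - (i \in J)%:R by rewrite !mxE.
rewrite [x 0 i]xE [y 0 i]mxE [(t *: c) 0 i]mxE.
case: (boolP (i \in I)) => iI; case: (boolP (i \in J)) => iJ; rewrite /= ?subrr ?mul0r//.
  by rewrite notp ?notq ?mulr0 ?addr0 ?subr0 ?subrr//; (by left) || (by right).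
by rewrite notp ?notq ?mulr0 ?addr0 ?subr0 ?subrr//; (by left) || (by right).
Qed.

Definition agree a b := [/\ forall I, (0 <= coordsum a I) = (0 <= coordsum b I),
  forall K, (0 <= balance K a) = (0 <= balance K b) &
  forall K, (0 <= balance K (- a)) = (0 <= balance K (- b))].

Lemma agreeN a b : H a -> H b -> agree a b -> agree (- a) (- b).
Proof.
move=> Ha Hb [e1 e2 e3]; split=> [I||K]; [|exact: e3|by rewrite !opprK].
by rewrite !coordsumN -!coordsumC.
Qed.

Lemma agree_meets a b I J : H a -> H b -> proper I -> proper J -> agree a b ->
  meets I J a -> meets I J b.
Proof.
move=> Ha Hb pI pJ ab.
have s1 (z : V) i : coordsum z [set i]%SET = z 0 i by rewrite /coordsum big_set1.
have ge0 i : 0 <= a 0 i -> 0 <= b 0 i by have [e _ _] := ab; have := e [set i]%SET; rewrite !s1 => ->.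
have le0 i : a 0 i <= 0 -> b 0 i <= 0.
  have [e _ _] := ab; have := e (~: [set i])%SET.
  by rewrite !coordsumC// !s1 !oppr_ge0 => ->.
have disj a' b' I' J' : H a' -> H b' -> agree a' b' ->
    (forall i, 0 <= a' 0 i -> 0 <= b' 0 i) -> (forall i, a' 0 i <= 0 -> b' 0 i <= 0) ->
    [disjoint I' & J']%B -> meets I' J' a' -> meets I' J' b'.
  move=> Ha' Hb' [_ e2 e3] g l dIJ; rewrite !meets_disjoint// => -[h1 h2 h3 h4].
  by split=> [i /h1/g|i /h2/l||]; rewrite -?e2 -?e3.
have [dIJ|/pred0Pn[p' /andP[/= pI' pJ']]] := boolP [disjoint I & J]%B; first exact: disj.
have [dIJ|/pred0Pn[q /andP[/=]]] := boolP [disjoint ~: I & ~: J]%B.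
  move=> /(meetsN Ha) m; rewrite -[I]finset.setCK -[J]finset.setCK -[b]opprK.
  apply: meetsN; first exact: HN.
  apply: disj m => //; [exact: HN|exact: HN|exact: agreeN| |].
    by move=> i; rewrite !mxE !oppr_ge0; apply: le0.
  by move=> i; rewrite !mxE !oppr_le0; apply: ge0.
rewrite !inE => qI qJ; rewrite !(meets_overlap _ pI' pJ' qI qJ)//.
move=> [h1 h2 h3 h4]; have [e _ _] := ab; split.
- by move=> i iI iJ; apply/ge0/h1.
- by move=> i iJ iI; apply/le0/h2.
- by have := e (~: J)%SET; rewrite !coordsumC// !oppr_ge0 h3.
- by rewrite -e.
Qed.

(** Two families of tests, with [A] the positive support of [a]: the pair [(A, ~A)] reveals the
    signs of the coordinates, and [(K :&: A, ~A)] the sign of [balance K], which depends only on the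
    part of [K] inside [A]. *)
Lemma meets_balance a b : H a -> H b -> a != 0 -> (forall i, a 0 i <> 0) ->
  (forall i, b 0 i <> 0) ->
  (forall I J, proper I -> proper J -> meets I J a -> meets I J b) ->
  (forall i, (0 < a 0 i) = (0 < b 0 i)) /\
  forall K, 0 <= balance K a -> 0 <= balance K b.
Proof.
move=> Ha Hb a_ne0 a0 b0 ab; pose A := [set i | 0 < a 0 i]%SET.
have ma := mass_gt0 Ha a_ne0.
have oppE (z : V) i : (- z) 0 i = - z 0 i by rewrite mxE.
have pA : proper A.
  split=> AE; move: ma; [|rewrite -(massN Ha)]; rewrite /mass big1 ?ltxx// => i _;
    apply: pos_eq0; move/finset.setP/(_ i): AE; rewrite !inE ?oppE.
    by move/negbT; rewrite -leNgt.
  by move=> ai; rewrite oppr_le0 ltW.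
have aA i : i \in A -> 0 <= a 0 i by rewrite inE => /ltW.
have aAC i : i \in (~: A)%SET -> a 0 i <= 0 by rewrite !inE -leNgt.
have posA : coordsum a A = mass a by rewrite massE.
have dAC : [disjoint A & ~: A]%B by rewrite -setI_eq0 finset.setICr.
have bAC : 0 <= balance (~: A)%SET (- a).
  rewrite balance_pos; first by rewrite massN// coordsumN coordsumC// opprK posA; lra.
  by move=> i /aAC; rewrite oppE oppr_ge0.
have sgn i : (0 < a 0 i) = (0 < b 0 i).
  have : meets A (~: A)%SET b.
    apply: ab => //; first exact: properC.
    by apply/meets_disjoint => //; split=> //; rewrite balance_pos// posA; lra.
  move=> /meets_disjoint[]// h1 h2 _ _; apply/idP/idP => ci.
    by rewrite lt_neqAle eq_sym h1 ?inE// andbT; apply/eqP.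
  rewrite ltNge; apply/negP => ai; have : b 0 i <= 0 by apply: h2; rewrite !inE -leNgt.
  by rewrite leNgt ci.
split=> // K; have balI (z : V) : (forall i, i \notin A -> z 0 i <= 0) ->
    balance (K :&: A)%SET z = balance K z.
  move=> zA; apply: eq_bigr => i _; have [iA|iA] := boolP (i \in A).
    by rewrite !mxE finset.in_setI iA andbT.
  by rewrite pos_eq0 ?zA// !mulr0.
have bA i : i \notin A -> b 0 i <= 0 by rewrite inE sgn -leNgt.
rewrite -(balI a) => [|i]; last by rewrite inE -leNgt.
rewrite -(balI b)// => bK.
(* An empty intersection would give the balance [- mass a], which is negative. *)
have pKA : proper (K :&: A)%SET.
  split=> KA; last by case: pA => _; apply; apply/eqP; rewrite -finset.subTset -KA finset.subsetIr.
  move: bK; rewrite KA balance_pos; last by move=> i; rewrite inE.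
  by rewrite /coordsum big_set0; lra.
have : meets (K :&: A)%SET (~: A)%SET b.
  apply: ab => //; first exact: properC.
  apply/meets_disjoint => //.
    by rewrite -setI_eq0 -finset.setIA finset.setICr finset.setI0.
  by split=> // i; rewrite finset.in_setI => /andP[_ /aA].
move=> /meets_disjoint[]//.
by rewrite -setI_eq0 -finset.setIA finset.setICr finset.setI0.
Qed.

(** The test pair is [I] with its part [J] where [a] is nonpositive: all conditions of
    [meets_overlap] then hold automatically, except [0 <= a(I)]. If [J] is empty, [b] is positive on
    [I]. *)
Lemma meets_coordsum a b I : H a -> H b -> (forall i, (0 < a 0 i) = (0 < b 0 i)) ->
  (forall I J, proper I -> proper J -> meets I J a -> meets I J b) ->
  0 <= coordsum a I -> 0 <= coordsum b I.
Proof.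
move=> Ha Hb sgn ab aI; pose A := [set i | 0 < a 0 i]%SET.
have [->|/eqP IT] := eqVneq I [set: 'I_d]%SET; first by rewrite [coordsum b _]Hb.
have [J0|/eqP J0] := eqVneq (I :&: ~: A)%SET finset.set0.
  apply: sumr_ge0 => i iI; move/finset.setP/(_ i): J0.
  by rewrite !inE iI /= sgn => /negbT; rewrite negbK => /ltW.
have /set0Pn[p] : (I :&: ~: A)%SET != finset.set0 by apply/eqP.
move=> pJ; have pI : p \in I by move: pJ; rewrite finset.in_setI => /andP[].
have [q _ qI] : exists2 q, q \in [set: 'I_d]%SET & q \notin I.
  by apply/fintype.subsetPn; rewrite finset.subTset; apply/eqP.
have qJ : q \notin (I :&: ~: A)%SET by rewrite finset.in_setI (negbTE qI).
have : meets I (I :&: ~: A)%SET b.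
  apply: ab.
  - by split=> // I0; move: pI; rewrite I0 inE.
  - by split=> // JT; move: qJ; rewrite JT inE.
  apply/(meets_overlap Ha pI pJ qI qJ); split=> //.
  - by move=> i iI; rewrite !inE iI /= negbK => /ltW.
  - by move=> i; rewrite finset.in_setI => /andP[->].
  by apply: sumr_le0 => i; rewrite !inE -leNgt => /andP[].
by move=> /(meets_overlap Hb pI pJ qI qJ)[].
Qed.

End Meeting.

(** * Equivalent bisectors correspond to equal cells *)

Section Main.
Variables (R : realType) (d : nat) (d2 : (1 < d)%N).
Local Notation V := 'rV[R]_d.
Local Notation P := (root_polytope R d).
Implicit Types (a b : V).

Lemma same_cell_agree a b : same_cell a b <-> agree a b.
Proof.
split=> [[[/ffunP e2 /ffunP e3] /ffunP e1]|[e1 e2 e3]].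
  by split=> K; [have := e1 K|have := e2 K|have := e3 K]; rewrite !ffunE.
by split; [rewrite /codes_of; congr (_, _)|]; apply/ffunP => K; rewrite !ffunE.
Qed.

(** The test lemmas transfer signs in one direction only, so they are applied to both orders of [a]
    and [b], and for the balances also to the opposite points by means of [meetsN]. *)
Lemma equiv_same_cell a b : regular a -> regular b ->
  bis_equiv P 0 a 0 b <-> same_cell a b.
Proof.
move=> [[Ha _] Ua] [[Hb _] Ub]; rewrite same_cell_agree bis_equivP//.
split=> [ab|ab I J pI pJ]; last first.
  split; apply: agree_meets => //.
  by have [e1 e2 e3] := ab; split=> K; rewrite ?e1 ?e2 ?e3.
have coord0 (c : V) : resonance_complement c -> forall i, c 0 i <> 0.
  move=> [Hc Uc] i; have := Uc [set i]%SET; rewrite /coordsum big_set1; apply.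
    by move=> /finset.setP/(_ i); rewrite !inE eqxx.
  move=> iT; have : #|[set i]%SET| = d by rewrite iT cardsT card_ord.
  by rewrite cards1 => d1; move: d2; rewrite -d1.
have [a0 b0] := (coord0 a Ua, coord0 b Ub).
have [an bn] := (resonance_neq0 d2 Ua, resonance_neq0 d2 Ub).
have mab I J : proper I -> proper J -> meets I J a -> meets I J b.
  by move=> pI pJ /(ab I J pI pJ).
have mba I J : proper I -> proper J -> meets I J b -> meets I J a.
  by move=> pI pJ /(ab I J pI pJ).
have opp (c c' : V) : H c -> H c' ->
    (forall I J, proper I -> proper J -> meets I J c -> meets I J c') ->
    forall I J, proper I -> proper J -> meets I J (- c) -> meets I J (- c').
  move=> Hc Hc' cc' I J pI pJ /(meetsN (HN Hc)); rewrite opprK.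
  move=> /(cc' _ _ (properC pI) (properC pJ))/(meetsN Hc').
  by rewrite !finset.setCK.
have opp0 (c : V) : (forall i, c 0 i <> 0) -> forall i, (- c) 0 i <> 0.
  by move=> c0 i; rewrite mxE => /eqP; rewrite oppr_eq0 => /eqP; apply: c0.
have [sgn balab] := meets_balance Ha Hb an a0 b0 mab.
have [sgn' balba] := meets_balance Hb Ha bn b0 a0 mba.
have [_ balabN] := meets_balance (HN Ha) (HN Hb) ltac:(by rewrite oppr_eq0)
  (opp0 _ a0) (opp0 _ b0) (opp _ _ Ha Hb mab).
have [_ balbaN] := meets_balance (HN Hb) (HN Ha) ltac:(by rewrite oppr_eq0)
  (opp0 _ b0) (opp0 _ a0) (opp _ _ Hb Ha mba).
split=> K; apply/idP/idP.
- exact: meets_coordsum.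
- exact: meets_coordsum.
- exact: balab.
- exact: balba.
- exact: balabN.
- exact: balbaN.
Qed.

End Main.

Theorem theorem7p4 (R : realType) (d : nat) (hd : (2 <= d)%N)
    (D : set (set 'rV[R]_d)) :
  is_bisection_fan (root_polytope R d) D <->
  D = common_refinement (linearity_fan R d) (resonance_fan R d).
Proof.
have [dense fanD] := bisection_fan_cells hd (@equiv_same_cell R d hd).
split=> [bD|->//].
exact: (bisection_fan_unique dense bD fanD).
Qed.
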